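(* For disjunctive finitely recursive programs $P$ and ground formulas $F$, the problem of deciding whether $F$ is a skeptical consequence of $P$ is semidecidable: there is a procedure which, given such $P$ and $F$, halts with a positive answer if and only if $F$ is a skeptical consequence of $P$.
   Context: A disjunctive program is a finite set of rules $A_1\vee\dots\vee A_m\leftarrow L_1,\dots,L_n$ ($m>0$, $n\ge0$), $A_j$ atoms, $L_i$ atoms or negated atoms $\mathtt{not}\,A$, possibly with function symbols; $head(r)=\{A_1,\dots,A_m\}$. $\mathsf{Ground}(P)$ is its ground instantiation. For a set $M$ of ground atoms, $P^M$ is obtained from $\mathsf{Ground}(P)$ by deleting rules having some $\mathtt{not}\,B$ in the body with $B\in M$ and deleting negative literals from the remaining rules; $M$ is a stable model iff it is a minimal Herbrand model of $P^M$. A ground formula is a closed propositional combination of ground atoms of the language of $P$; it is a skeptical consequence of $P$ iff it is true in every stable model of $P$. The dependency graph has ground atoms as vertices and an edge $A\to B$ whenever some $r\in\mathsf{Ground}(P)$ has $A\in head(r)$ and $B$ occurring in $r$ (body or head); $A$ depends on $B$ if there is a directed path from $A$ to $B$ (every atom depends on itself). $P$ is finitely recursive iff each ground atom depends on finitely many ground atoms. *)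

(* Defs.v *)
From Stdlib Require Import Arith List Relations.
Import ListNotations.

Inductive PR : Type :=
| PZero : PR
| PSucc : PR
| PProj : nat -> PR
| PComp : PR -> list PR -> PR
| PRec  : PR -> PR -> PR
| PMu   : PR -> PR.

Inductive pr_eval : PR -> list nat -> nat -> Prop :=
| ev_zero : forall xs, pr_eval PZero xs 0
| ev_succ : forall x xs, pr_eval PSucc (x :: xs) (S x)
| ev_proj : forall i xs, i < length xs -> pr_eval (PProj i) xs (nth i xs 0)
| ev_comp : forall f gs xs ys v,
    pr_evals gs xs ys -> pr_eval f ys v -> pr_eval (PComp f gs) xs v
| ev_rec0 : forall f g xs v,
    pr_eval f xs v -> pr_eval (PRec f g) (0 :: xs) v
| ev_recS : forall f g n xs u v,
    pr_eval (PRec f g) (n :: xs) u -> pr_eval g (n :: u :: xs) v ->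
    pr_eval (PRec f g) (S n :: xs) v
| ev_mu : forall f xs n,
    pr_eval f (n :: xs) 0 ->
    (forall m, m < n -> exists k, pr_eval f (m :: xs) (S k)) ->
    pr_eval (PMu f) xs n
with pr_evals : list PR -> list nat -> list nat -> Prop :=
| evs_nil : forall xs, pr_evals [] xs []
| evs_cons : forall g gs xs y ys,
    pr_eval g xs y -> pr_evals gs xs ys -> pr_evals (g :: gs) xs (y :: ys).

(*    Function / predicate symbols are identified by (name, arity).   *)

Inductive term : Type :=
| Var : nat -> term
| Fn  : nat -> list term -> term.

Inductive atom : Type := At (p : nat) (args : list term).

Inductive literal : Type :=
| Pos : atom -> literal
| Neg : atom -> literal.

Record rule : Type := mkRule { head : list atom; body : list literal }.

Definition program := list rule.

Definition disjunctive_program (P : program) : Prop :=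
  forall r, In r P -> head r <> [].

Inductive formula : Type :=
| FAtom : atom -> formula
| FNot  : formula -> formula
| FAnd  : formula -> formula -> formula
| FOr   : formula -> formula -> formula
| FImp  : formula -> formula -> formula.

Fixpoint subst_term (s : nat -> term) (t : term) : term :=
  match t with
  | Var n => s n
  | Fn f ts => Fn f (map (subst_term s) ts)
  end.

Definition subst_atom (s : nat -> term) (a : atom) : atom :=
  match a with At p ts => At p (map (subst_term s) ts) end.

Definition subst_lit (s : nat -> term) (l : literal) : literal :=
  match l with Pos a => Pos (subst_atom s a) | Neg a => Neg (subst_atom s a) end.

Definition subst_rule (s : nat -> term) (r : rule) : rule :=
  mkRule (map (subst_atom s) (head r)) (map (subst_lit s) (body r)).

Fixpoint funs_term (t : term) : list (nat * nat) :=
  match t with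
  | Var _ => []
  | Fn f ts => (f, length ts) :: flat_map funs_term ts
  end.

Definition funs_atom (a : atom) : list (nat * nat) :=
  match a with At _ ts => flat_map funs_term ts end.

Definition atom_of_lit (l : literal) : atom :=
  match l with Pos a => a | Neg a => a end.

Definition atoms_of_rule (r : rule) : list atom :=
  head r ++ map atom_of_lit (body r).

Definition funs_prog (P : program) : list (nat * nat) :=
  flat_map (fun r => flat_map funs_atom (atoms_of_rule r)) P.

Definition preds_prog (P : program) : list (nat * nat) :=
  flat_map (fun r => map (fun a => match a with At p ts => (p, length ts) end)
                         (atoms_of_rule r)) P.

(* Function symbols of the Herbrand universe: those of P, plus a fresh
   constant (symbol 0 of arity 0) when P contains no constant. *)
Definition herbrand_funs (P : program) : list (nat * nat) :=
  if existsb (fun fa => Nat.eqb (snd fa) 0) (funs_prog P)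
  then funs_prog P else (0, 0) :: funs_prog P.

Fixpoint term_in (sig : list (nat * nat)) (t : term) : Prop :=
  match t with
  | Var _ => False
  | Fn f ts => In (f, length ts) sig /\
      (fix all_in (l : list term) : Prop :=
         match l with [] => True | u :: l' => term_in sig u /\ all_in l' end) ts
  end.

Definition herbrand_term (P : program) (t : term) : Prop :=
  term_in (herbrand_funs P) t.

Definition herbrand_atom (P : program) (a : atom) : Prop :=
  match a with
  | At p ts => In (p, length ts) (preds_prog P) /\ Forall (herbrand_term P) ts
  end.

Fixpoint term_ground (t : term) : Prop :=
  match t with
  | Var _ => False
  | Fn _ ts =>
      (fix all_g (l : list term) : Prop :=
         match l with [] => True | u :: l' => term_ground u /\ all_g l' end) ts
  end.

Definition ground_atom (a : atom) : Prop :=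
  match a with At _ ts => Forall term_ground ts end.

Fixpoint formula_of (P : program) (F : formula) : Prop :=
  match F with
  | FAtom a => herbrand_atom P a
  | FNot G => formula_of P G
  | FAnd G H | FOr G H | FImp G H => formula_of P G /\ formula_of P H
  end.

Definition ground_subst (P : program) (s : nat -> term) : Prop :=
  forall n, herbrand_term P (s n).

Definition ground_rule (P : program) (g : rule) : Prop :=
  exists r s, In r P /\ ground_subst P s /\ g = subst_rule s r.

Definition interp := atom -> Prop.

Definition herbrand_interp (P : program) (M : interp) : Prop :=
  forall a, M a -> herbrand_atom P a.

Definition pos_body (r : rule) : list atom :=
  flat_map (fun l => match l with Pos a => [a] | Neg _ => [] end) (body r).

(* The Gelfond-Lifschitz reduct P^M: the positive rule  h <- b  belongs to
   P^M iff it is obtained from some rule of Ground(P) none of whose negative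
   body literals  not B  has B in M, by deleting the negative literals. *)
Definition in_reduct (P : program) (M : interp) (h b : list atom) : Prop :=
  exists g, ground_rule P g /\
    (forall B, In (Neg B) (body g) -> ~ M B) /\
    h = head g /\ b = pos_body g.

Definition model_of_reduct (P : program) (M N : interp) : Prop :=
  forall h b, in_reduct P M h b ->
    (forall A, In A b -> N A) -> exists A, In A h /\ N A.

Definition stable_model (P : program) (M : interp) : Prop :=
  herbrand_interp P M /\ model_of_reduct P M M /\
  forall N, herbrand_interp P N -> model_of_reduct P M N ->
    (forall a, N a -> M a) -> forall a, M a -> N a.

Fixpoint holds (M : interp) (F : formula) : Prop :=
  match F with
  | FAtom a => M a
  | FNot G => ~ holds M G
  | FAnd G H => holds M G /\ holds M H
  | FOr G H => holds M G \/ holds M H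
  | FImp G H => holds M G -> holds M H
  end.

Definition skeptical_consequence (P : program) (F : formula) : Prop :=
  forall M, stable_model P M -> holds M F.

Definition dep_edge (P : program) (A B : atom) : Prop :=
  exists g, ground_rule P g /\ In A (head g) /\ In B (atoms_of_rule g).

Definition depends (P : program) : atom -> atom -> Prop :=
  clos_refl_trans atom (dep_edge P).

Definition finitely_recursive (P : program) : Prop :=
  forall A, ground_atom A -> exists l : list atom, forall B, depends P A B -> In B l.

Definition cpair (a b : nat) : nat := (a + b) * (a + b + 1) / 2 + b.

Definition enc_list {A} (e : A -> nat) : list A -> nat :=
  fix go l := match l with [] => 0 | x :: l' => S (cpair (e x) (go l')) end.

Fixpoint enc_term (t : term) : nat :=
  match t with
  | Var n => cpair 0 n
  | Fn f ts => cpair 1 (cpair f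
      ((fix go (l : list term) : nat :=
          match l with [] => 0 | u :: l' => S (cpair (enc_term u) (go l')) end) ts))
  end.

Definition enc_atom (a : atom) : nat :=
  match a with At p ts => cpair p (enc_list enc_term ts) end.

Definition enc_lit (l : literal) : nat :=
  match l with Pos a => cpair 0 (enc_atom a) | Neg a => cpair 1 (enc_atom a) end.

Definition enc_rule (r : rule) : nat :=
  cpair (enc_list enc_atom (head r)) (enc_list enc_lit (body r)).

Definition enc_program (P : program) : nat := enc_list enc_rule P.

Fixpoint enc_formula (F : formula) : nat :=
  match F with
  | FAtom a => cpair 0 (enc_atom a)
  | FNot G => cpair 1 (enc_formula G)
  | FAnd G H => cpair 2 (cpair (enc_formula G) (enc_formula H))
  | FOr G H => cpair 3 (cpair (enc_formula G) (enc_formula H))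
  | FImp G H => cpair 4 (cpair (enc_formula G) (enc_formula H))
  end.

Definition enc_input (P : program) (F : formula) : nat :=
  cpair (enc_program P) (enc_formula F).

(* Main.v *)
(** The certificate for a positive answer is a number [n] such that some finite set
    [U] of atoms over the Herbrand terms of depth at most [n] contains the atoms of
    [F], is closed under dependency, and every stable model of the rules with head in
    [U] satisfies [F].  Closedness is decidable because it is enough to test the
    rule instances over terms of depth at most [n+1]: a value of a substitution that
    is too deep can be replaced by a term of depth exactly [n+1], which is still
    outside every atom of [U].

    Soundness is the splitting property: a stable model of [P] restricts to a stable
    model of the rules with head in a closed set.  For completeness, if no certificate
    exists then each of the finite closed sets [U_n] generated by the atoms of [F] and
    the first [n] Herbrand atoms carries a stable model falsifying [F]; by Koenig's
    lemma these have a limit, which is a stable model of [P] falsifying [F].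

    The certificate test is recursive because functions on coded data are closed
    under pairing, list iteration and course-of-values recursion on codes. *)

From Stdlib Require Import Arith Lia Bool Classical ClassicalEpsilon Relations List.
Require Import Defs.
Import ListNotations.

(** * Computable functions on coded data *)


(** The inner fixpoint supplies induction hypotheses for the codes listed under [PComp], which the
    generated principle omits. *)
Fixpoint PR_nested_ind (Q : PR -> Prop) (HZ : Q PZero) (HS : Q PSucc)
    (HP : forall i, Q (PProj i))
    (HC : forall f gs, Q f -> Forall Q gs -> Q (PComp f gs))
    (HR : forall f g, Q f -> Q g -> Q (PRec f g))
    (HM : forall f, Q f -> Q (PMu f)) (c : PR) : Q c :=
  let IH := PR_nested_ind Q HZ HS HP HC HR HM in
  match c with
  | PZero => HZ
  | PSucc => HS
  | PProj i => HP i
  | PComp f gs => HC f gs (IH f)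
      ((fix all (l : list PR) : Forall Q l :=
          match l with
          | [] => Forall_nil Q
          | g :: l' => Forall_cons g (IH g) (all l')
          end) gs)
  | PRec f g => HR f g (IH f) (IH g)
  | PMu f => HM f (IH f)
  end.

(** Serves to read a halting search backwards: the value 0 met by the minimisation must be the known
    value of the test. *)
Lemma pr_eval_det c : forall xs v w, pr_eval c xs v -> pr_eval c xs w -> v = w.
Proof.
induction c as [| |i|f gs IHf IHgs|f g IHf IHg|f IHf] using PR_nested_ind;
  intros xs v w H1 H2.
- inversion H1; subst; inversion H2; subst; reflexivity.
- inversion H1; subst; inversion H2; subst; congruence.
- inversion H1; subst; inversion H2; subst; reflexivity.
- inversion H1 as [| | |? ? ? ys ? Hs Hf| | |]; subst.
  inversion H2 as [| | |? ? ? zs ? Hs' Hf'| | |]; subst.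
  enough (ys = zs) by (subst; eauto).
  clear - IHgs Hs Hs'. revert ys zs Hs Hs'.
  induction IHgs; intros ys zs H1 H2; inversion H1; inversion H2; subst; auto.
  f_equal; eauto.
(* Unfolding [PRec f g] calls the same code on a smaller counter, where structural induction is
   silent; hence a second induction on the counter. *)
- assert (Hrec : forall n xs v w, pr_eval (PRec f g) (n :: xs) v ->
      pr_eval (PRec f g) (n :: xs) w -> v = w).
  { clear - IHf IHg. induction n as [|n IHn]; intros xs v w H1 H2.
    - inversion H1; subst; inversion H2; subst; eauto.
    - inversion H1 as [| | | | |? ? ? ? u ? Hu Hv|]; subst.
      inversion H2 as [| | | | |? ? ? ? u' ? Hu' Hv'|]; subst.
      assert (u = u') by eauto; subst; eauto. }
  destruct xs as [|n xs]; [inversion H1|eauto].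
- inversion H1 as [| | | | | |? ? ? Hv Lv]; subst.
  inversion H2 as [| | | | | |? ? ? Hw Lw]; subst.
  (* If the two results differ, [f] is 0 at the smaller one, while the run with the larger result
     requires a successor there. *)
  destruct (Nat.lt_trichotomy v w) as [L|[L|L]]; auto.
  + destruct (Lw v L) as [k Hk]. discriminate (IHf _ _ _ Hv Hk).
  + destruct (Lv w L) as [k Hk]. discriminate (IHf _ _ _ Hw Hk).
Qed.

(** * Inverses of the Cantor pairing function, by way of triangular numbers *)

Fixpoint tri (n : nat) : nat :=
  match n with 0 => 0 | S k => tri k + S k end.

Lemma cpair_tri a b : cpair a b = tri (a + b) + b.
Proof.
unfold cpair. f_equal. generalize (a + b). intros n. symmetry.
apply Nat.div_unique with 0; [lia|].
induction n as [|n IH]; simpl tri; lia.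
Qed.

Lemma tri_le m n : m <= n -> tri m <= tri n.
Proof. induction 1; simpl; lia. Qed.

(* [diag n] is the number [a + b] of the antidiagonal containing [n = cpair a b];
   truncated subtraction makes the increment 0 or 1. *)
Fixpoint diag (n : nat) : nat :=
  match n with
  | 0 => 0
  | S k => diag k + (1 - (tri (S (diag k)) - S k))
  end.

Lemma diag_spec n : tri (diag n) <= n < tri (S (diag n)).
Proof.
induction n as [|n IH]; [simpl; lia|].
change (diag (S n)) with (diag n + (1 - (tri (S (diag n)) - S n))).
assert (tri (S (S (diag n))) = tri (S (diag n)) + S (S (diag n))) by reflexivity.
assert (tri (S (diag n)) = tri (diag n) + S (diag n)) by reflexivity.
destruct (Nat.leb_spec (tri (S (diag n))) (S n)) as [L|L].
- replace (1 - (tri (S (diag n)) - S n)) with 1 by lia. rewrite Nat.add_1_r. lia.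
- replace (1 - (tri (S (diag n)) - S n)) with 0 by lia. rewrite Nat.add_0_r. lia.
Qed.

Definition unsnd (n : nat) : nat := n - tri (diag n).
Definition unfst (n : nat) : nat := diag n - unsnd n.

(** The code lies between [tri (a + b)] and [tri (S (a + b))], and the intervals between consecutive
    triangular numbers are disjoint. *)
Lemma diag_cpair a b : diag (cpair a b) = a + b.
Proof.
pose proof (diag_spec (cpair a b)) as [H1 H2].
rewrite (cpair_tri a b) in *. set (d := diag _) in *.
destruct (Nat.lt_trichotomy d (a + b)) as [H|[H|H]]; auto.
- apply (tri_le (S d)) in H. lia.
- apply (tri_le (S (a + b))) in H. simpl in H. lia.
Qed.

Lemma unsnd_cpair a b : unsnd (cpair a b) = b.
Proof. unfold unsnd. rewrite diag_cpair, cpair_tri. lia. Qed.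

Lemma unfst_cpair a b : unfst (cpair a b) = a.
Proof. unfold unfst. rewrite unsnd_cpair, diag_cpair. lia. Qed.

Lemma cpair_inj a b a' b' : cpair a b = cpair a' b' -> a = a' /\ b = b'.
Proof.
intros H. split.
- rewrite <- (unfst_cpair a b), H. apply unfst_cpair.
- rewrite <- (unsnd_cpair a b), H. apply unsnd_cpair.
Qed.

Lemma tri_ge n : n <= tri n.
Proof. induction n; simpl; lia. Qed.

Lemma le_cpair_l a b : a <= cpair a b.
Proof. rewrite cpair_tri. pose proof (tri_ge (a + b)). lia. Qed.

Lemma le_cpair_r a b : b <= cpair a b.
Proof. rewrite cpair_tri. lia. Qed.

(** * Recursive functions of one and two numbers *)

Definition rec1 (f : nat -> nat) : Prop :=
  exists c, forall n, pr_eval c [n] (f n).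
Definition rec2 (f : nat -> nat -> nat) : Prop :=
  exists c, forall m n, pr_eval c [m; n] (f m n).

Lemma evals_1 g xs y : pr_eval g xs y -> pr_evals [g] xs [y].
Proof. intros; repeat constructor; auto. Qed.

Lemma evals_2 g h xs y z :
  pr_eval g xs y -> pr_eval h xs z -> pr_evals [g; h] xs [y; z].
Proof. intros; repeat constructor; auto. Qed.

Lemma eval_proj i xs v :
  nth_error xs i = Some v -> pr_eval (PProj i) xs v.
Proof.
intros H. rewrite <- (nth_error_nth xs i 0 H). constructor.
apply nth_error_Some. congruence.
Qed.

Lemma rec1_id : rec1 (fun n => n).
Proof. exists (PProj 0). intros. now apply eval_proj. Qed.

Lemma rec1_S : rec1 S.
Proof. exists PSucc. intros. constructor. Qed.

Lemma rec1_comp f g : rec1 f -> rec1 g -> rec1 (fun n => f (g n)).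
Proof.
intros [c Hc] [d Hd]. exists (PComp c [d]). intros n.
econstructor; [apply evals_1|]; eauto.
Qed.

Lemma rec1_const k : rec1 (fun _ => k).
Proof.
induction k as [|k IH]; [exists PZero; constructor|].
exact (rec1_comp _ _ rec1_S IH).
Qed.

Lemma rec1_comp2 f g h :
  rec2 f -> rec1 g -> rec1 h -> rec1 (fun n => f (g n) (h n)).
Proof.
intros [c Hc] [d Hd] [e He]. exists (PComp c [d; e]). intros n.
econstructor; [apply evals_2|]; eauto.
Qed.

Lemma rec2_comp1 f g : rec1 f -> rec2 g -> rec2 (fun m n => f (g m n)).
Proof.
intros [c Hc] [d Hd]. exists (PComp c [d]). intros m n.
econstructor; [apply evals_1|]; eauto.
Qed.

Lemma rec2_comp2 f g h :
  rec2 f -> rec2 g -> rec2 h -> rec2 (fun m n => f (g m n) (h m n)).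
Proof.
intros [c Hc] [d Hd] [e He]. exists (PComp c [d; e]). intros m n.
econstructor; [apply evals_2|]; eauto.
Qed.

Lemma rec2_l : rec2 (fun m _ => m).
Proof. exists (PProj 0). intros. now apply eval_proj. Qed.

Lemma rec2_r : rec2 (fun _ n => n).
Proof. exists (PProj 1). intros. now apply eval_proj. Qed.

Lemma rec2_add : rec2 Nat.add.
Proof.
exists (PRec (PProj 0) (PComp PSucc [PProj 1])). intros m n.
induction m as [|m IH].
- constructor. now apply eval_proj.
- econstructor; [apply IH|].
  econstructor; [apply evals_1; now apply eval_proj|constructor].
Qed.

Lemma rec1_pred : rec1 Nat.pred.
Proof.
exists (PRec PZero (PProj 0)). intros n. induction n as [|n IH].
- constructor. constructor.
- econstructor; [apply IH|]. now apply eval_proj.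
Qed.

Lemma rec2_sub : rec2 Nat.sub.
Proof.
destruct rec1_pred as [p Hp].
(* [PRec] recurs on its first argument, so the arguments are exchanged first; inside the step, entry
   1 is the previous value, whose predecessor is taken. *)
exists (PComp (PRec (PProj 0) (PComp p [PComp (PProj 0) [PProj 1]]))
              [PProj 1; PProj 0]).
intros m n. econstructor; [apply evals_2; now apply eval_proj|].
induction n as [|n IH].
- constructor. rewrite Nat.sub_0_r. now apply eval_proj.
- econstructor; [apply IH|]. rewrite Nat.sub_succ_r.
  econstructor; [apply evals_1|apply Hp].
  econstructor; [apply evals_1|]; now apply eval_proj.
Qed.

(** Recursion without a parameter, enough for [tri] and [diag]; recursion with a parameter must wait
    until pairing is available. *)
Lemma rec1_rec0 g :
  rec2 g -> rec1 (fun n => nat_rect (fun _ => nat) 0 g n).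
Proof.
intros [c Hc].
exists (PRec PZero c). intros n. induction n as [|n IH].
- constructor. constructor.
- econstructor; [apply IH|]. apply Hc.
Qed.

Lemma rec1_ext f g : (forall n, f n = g n) -> rec1 f -> rec1 g.
Proof. intros E [c Hc]. exists c. intros n. rewrite <- E. apply Hc. Qed.

Lemma rec2_ext f g : (forall m n, f m n = g m n) -> rec2 f -> rec2 g.
Proof. intros E [c Hc]. exists c. intros m n. rewrite <- E. apply Hc. Qed.

Lemma rec1_tri : rec1 tri.
Proof.
apply rec1_ext with (fun n => nat_rect (fun _ => nat) 0 (fun k t => t + S k) n).
{ intros n; induction n; simpl; congruence. }
apply rec1_rec0, rec2_comp2; [apply rec2_add|apply rec2_r|].
apply rec2_comp1; [apply rec1_S|apply rec2_l].
Qed.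

Lemma rec1_diag : rec1 diag.
Proof.
apply rec1_ext with
  (fun n => nat_rect (fun _ => nat) 0 (fun k d => d + (1 - (tri (S d) - S k))) n).
{ intros n; induction n as [|n IH]; [reflexivity|].
  cbn [nat_rect]. rewrite IH. reflexivity. }
apply rec1_rec0, rec2_comp2; [apply rec2_add|apply rec2_r|].
apply rec2_comp2; [apply rec2_sub| |].
{ apply (rec2_comp1 (fun _ => 1) (fun m _ => m)); [apply rec1_const|apply rec2_l]. }
apply rec2_comp2; [apply rec2_sub| |].
- apply (rec2_comp1 (fun d => tri (S d)) (fun _ d => d)); [|apply rec2_r].
  apply rec1_comp; [apply rec1_tri|apply rec1_S].
- apply rec2_comp1; [apply rec1_S|apply rec2_l].
Qed.

Lemma rec2_cpair : rec2 cpair.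
Proof.
apply rec2_ext with (fun a b => tri (a + b) + b);
  [intros; symmetry; apply cpair_tri|].
apply rec2_comp2; [apply rec2_add| |apply rec2_r].
apply rec2_comp1; [apply rec1_tri|apply rec2_add].
Qed.

Lemma rec1_unsnd : rec1 unsnd.
Proof.
apply rec1_comp2; [apply rec2_sub|apply rec1_id|].
apply rec1_comp; [apply rec1_tri|apply rec1_diag].
Qed.

Lemma rec1_unfst : rec1 unfst.
Proof. apply rec1_comp2; [apply rec2_sub|apply rec1_diag|apply rec1_unsnd]. Qed.

(** Parameter and counter are packed into one number, so that unary functions suffice from here
    on. *)
Lemma rec1_nat_rect f g : rec1 f -> rec1 g ->
  rec1 (fun x => nat_rect (fun _ => nat) (f (unfst x))
                   (fun n v => g (cpair (unfst x) (cpair n v))) (unsnd x)).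
Proof.
intros [c Hc] [d Hd].
destruct rec2_cpair as [p Hp], rec1_unfst as [q Hq], rec1_unsnd as [r Hr].
(* The context of the recursive step is index, previous value, parameter; [PProj 2] is therefore the
   parameter. *)
exists (PComp (PRec c (PComp d [PComp p [PProj 2; PComp p [PProj 0; PProj 1]]]))
              [r; q]).
intros x. econstructor; [apply evals_2; eauto|].
induction (unsnd x) as [|n IH]; simpl.
- constructor. apply Hc.
- econstructor; [apply IH|].
  econstructor; [apply evals_1|apply Hd].
  econstructor; [apply evals_2|apply Hp]; [now apply eval_proj|].
  econstructor; [apply evals_2|apply Hp]; now apply eval_proj.
Qed.

(** * Encoded types and the computable functions between them *)

Class Enc (A : Type) := enc : A -> nat.
#[export] Instance Enc_nat : Enc nat := fun n => n.
#[export] Instance Enc_bool : Enc bool := fun b => if b then 1 else 0.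
#[export] Instance Enc_prod {A B} `{Enc A} `{Enc B} : Enc (A * B) :=
  fun p => cpair (enc (fst p)) (enc (snd p)).
#[export] Instance Enc_list {A} `{Enc A} : Enc (list A) := enc_list enc.
#[export] Instance Enc_term : Enc term := enc_term.
#[export] Instance Enc_atom : Enc atom := enc_atom.
#[export] Instance Enc_lit : Enc literal := enc_lit.
#[export] Instance Enc_rule : Enc rule := enc_rule.
#[export] Instance Enc_formula : Enc formula := enc_formula.

(** The tracking function is constrained on codes only and may do anything on other numbers, so no
    test for being a code is ever needed. *)
Definition computable {A B} `{Enc A} `{Enc B} (f : A -> B) : Prop :=
  exists g, rec1 g /\ forall a, g (enc a) = enc (f a).

Lemma computable_ext {A B} `{Enc A} `{Enc B} (f g : A -> B) :
  (forall a, f a = g a) -> computable f -> computable g.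
Proof. intros E (h & Hh & Eh). exists h. split; auto. intros a. now rewrite <- E. Qed.

Lemma comp_raw g : rec1 g -> computable g.
Proof. intros Hg. exists g. split; auto. Qed.

(** Covers constructors and views that leave the code unchanged, such as passing between an atom and
    the pair of its symbol and arguments. *)
Lemma comp_recode {A B} `{Enc A} `{Enc B} (f : A -> B) :
  (forall a, enc (f a) = enc a) -> computable f.
Proof. intros E. exists (fun n => n). split; [apply rec1_id|auto]. Qed.

Lemma comp_id {A} `{Enc A} : computable (fun a : A => a).
Proof. apply comp_recode; auto. Qed.

Lemma comp_const {A B} `{Enc A} `{Enc B} (b : B) : computable (fun _ : A => b).
Proof. exists (fun _ => enc b). split; auto. apply rec1_const. Qed.

Lemma comp_app {A B C} `{Enc A} `{Enc B} `{Enc C} (f : B -> C) (g : A -> B) :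
  computable f -> computable g -> computable (fun a => f (g a)).
Proof.
intros (f' & Hf & Ef) (g' & Hg & Eg). exists (fun n => f' (g' n)). split.
- now apply rec1_comp.
- intros a. now rewrite Eg, Ef.
Qed.

Lemma comp_pair {A B C} `{Enc A} `{Enc B} `{Enc C} (f : A -> B) (g : A -> C) :
  computable f -> computable g -> computable (fun a => (f a, g a)).
Proof.
intros (f' & Hf & Ef) (g' & Hg & Eg). exists (fun n => cpair (f' n) (g' n)). split.
- apply rec1_comp2; auto using rec2_cpair.
- intros a. now rewrite Eg, Ef.
Qed.

Lemma comp_app2 {A B C D} `{Enc A} `{Enc B} `{Enc C} `{Enc D}
    (f : B -> C -> D) (g : A -> B) (h : A -> C) :
  computable (fun p : B * C => f (fst p) (snd p)) ->
  computable g -> computable h -> computable (fun a => f (g a) (h a)).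
Proof.
intros Hf Hg Hh. exact (comp_app _ _ Hf (comp_pair _ _ Hg Hh)).
Qed.

Lemma comp_fst {A B C} `{Enc A} `{Enc B} `{Enc C} (f : A -> B * C) :
  computable f -> computable (fun a => fst (f a)).
Proof.
apply comp_app. exists unfst. split; [apply rec1_unfst|].
intros a. apply unfst_cpair.
Qed.

Lemma comp_snd {A B C} `{Enc A} `{Enc B} `{Enc C} (f : A -> B * C) :
  computable f -> computable (fun a => snd (f a)).
Proof.
apply comp_app. exists unsnd. split; [apply rec1_unsnd|].
intros a. apply unsnd_cpair.
Qed.

Lemma comp_enc {A B} `{Enc A} `{Enc B} (f : A -> B) :
  computable f -> computable (fun a => enc (f a)).
Proof. apply comp_app. now apply comp_recode. Qed.

Lemma comp_nat_rect {A B} `{Enc A} `{Enc B}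
    (b : A -> B) (s : A -> nat -> B -> B) (k : A -> nat) :
  computable b ->
  computable (fun p : A * (nat * B) => s (fst p) (fst (snd p)) (snd (snd p))) ->
  computable k ->
  computable (fun a => nat_rect (fun _ => B) (b a) (s a) (k a)).
Proof.
intros (b' & Hb & Eb) (s' & Hs & Es) (k' & Hk & Ek).
exists (fun n => let x := cpair n (k' n) in
  nat_rect (fun _ => nat) (b' (unfst x))
    (fun m v => s' (cpair (unfst x) (cpair m v))) (unsnd x)).
split.
- apply (rec1_comp (fun x => nat_rect (fun _ => nat) (b' (unfst x))
    (fun m v => s' (cpair (unfst x) (cpair m v))) (unsnd x))).
  + now apply rec1_nat_rect.
  + apply rec1_comp2; auto using rec2_cpair, rec1_id.
- intros a. cbv zeta. rewrite unfst_cpair, unsnd_cpair, Ek.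
  change (enc (k a)) with (k a).
  induction (k a) as [|n IH]; simpl; auto.
  rewrite IH. apply (Es (a, (n, _))).
Qed.

Lemma comp_S {A} `{Enc A} (f : A -> nat) :
  computable f -> computable (fun a => S (f a)).
Proof. apply comp_app, comp_raw, rec1_S. Qed.

Lemma comp_sub {A} `{Enc A} (f g : A -> nat) :
  computable f -> computable g -> computable (fun a => f a - g a).
Proof.
apply comp_app2. exists (fun n => unfst n - unsnd n). split.
- apply rec1_comp2; auto using rec2_sub, rec1_unfst, rec1_unsnd.
- intros [m n]. change (enc (m, n)) with (cpair m n). now rewrite unfst_cpair, unsnd_cpair.
Qed.

Lemma comp_cpair {A} `{Enc A} (f g : A -> nat) :
  computable f -> computable g -> computable (fun a => cpair (f a) (g a)).
Proof. apply comp_app2. now apply comp_recode. Qed.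

Lemma comp_if {A B} `{Enc A} `{Enc B} (c : A -> bool) (f g : A -> B) :
  computable c -> computable f -> computable g ->
  computable (fun a => if c a then f a else g a).
Proof.
intros (c' & Hc & Ec) Hf Hg.
(* A conditional is a recursion of one step or none. *)
apply computable_ext with
  (f := fun a => nat_rect (fun _ => B) (g a) (fun _ _ => f a) (if c a then 1 else 0)).
{ intros a. now destruct (c a). }
apply comp_nat_rect; auto.
- apply (comp_app f); auto. apply comp_fst, comp_id.
- exists c'. auto.
Qed.

Lemma comp_negb {A} `{Enc A} (f : A -> bool) :
  computable f -> computable (fun a => negb (f a)).
Proof.
intros. apply computable_ext with (f := fun a => if f a then false else true).
{ now intros a; destruct (f a). }
apply comp_if; auto using comp_const.
Qed.

Lemma comp_andb {A} `{Enc A} (f g : A -> bool) :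
  computable f -> computable g -> computable (fun a => f a && g a).
Proof. intros. apply comp_if; auto using comp_const. Qed.

Lemma comp_orb {A} `{Enc A} (f g : A -> bool) :
  computable f -> computable g -> computable (fun a => f a || g a).
Proof. intros. apply comp_if; auto using comp_const. Qed.

Lemma comp_implb {A} `{Enc A} (f g : A -> bool) :
  computable f -> computable g -> computable (fun a => implb (f a) (g a)).
Proof. intros. apply comp_if; auto using comp_const. Qed.

Lemma comp_eq0 {A} `{Enc A} (f : A -> nat) :
  computable f -> computable (fun a => f a =? 0).
Proof.
intros (f' & Hf & Ef). exists (fun n => 1 - f' n). split.
- apply rec1_comp2; auto using rec2_sub, rec1_const.
- intros a. rewrite Ef. now destruct (f a) as [|[|]].
Qed.

Lemma comp_eqb {A} `{Enc A} (f g : A -> nat) :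
  computable f -> computable g -> computable (fun a => f a =? g a).
Proof.
intros. apply computable_ext with (f := fun a => (f a - g a =? 0) && (g a - f a =? 0)).
{ intros a. apply eq_true_iff_eq. rewrite andb_true_iff, !Nat.eqb_eq. lia. }
apply comp_andb; apply comp_eq0; now apply comp_sub.
Qed.

Lemma enc_cons {A} `{Enc A} (a : A) (l : list A) :
  enc (a :: l) = S (cpair (enc a) (enc l)).
Proof. reflexivity. Qed.

Lemma comp_cons {A B} `{Enc A} `{Enc B} (f : A -> B) (g : A -> list B) :
  computable f -> computable g -> computable (fun a => f a :: g a).
Proof.
apply (comp_app2 (fun b l => b :: l)). exists S. split; [apply rec1_S|]. now intros [].
Qed.

Lemma length_le_enc {A} `{Enc A} (l : list A) : length l <= enc l.
Proof.
induction l; [auto|]. rewrite enc_cons. simpl.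
pose proof (le_cpair_r (enc a) (enc l)). lia.
Qed.

(* A list is consumed by iterating a step on the pair (remaining code,
   accumulator); the code of the list is itself a large enough number of steps. *)
Lemma comp_fold_left {A B C} `{Enc A} `{Enc B} `{Enc C}
    (f : A -> C -> B -> C) (l : A -> list B) (c : A -> C) :
  computable (fun p : A * (C * B) => f (fst p) (fst (snd p)) (snd (snd p))) ->
  computable l -> computable c ->
  computable (fun a => fold_left (f a) (l a) (c a)).
Proof.
intros (f' & Hf & Ef) (l' & Hl & El) (c' & Hc & Ec).
set (step := fun (x : nat) (_ : nat) (s : nat * nat) =>
  if fst s =? 0 then s
  else (unsnd (pred (fst s)),
        f' (cpair x (cpair (snd s) (unfst (pred (fst s))))))).
assert (Hg : computable (fun x : nat =>
  snd (nat_rect (fun _ => (nat * nat)%type) (l' x, c' x) (step x) (l' x)))).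
{ apply comp_snd, comp_nat_rect.
  - apply comp_pair; now apply comp_raw.
  - unfold step.
    assert (computable (fun p : nat * (nat * (nat * nat)) => fst (snd (snd p)))) by
      apply comp_fst, comp_snd, comp_snd, comp_id.
    assert (computable (fun p : nat * (nat * (nat * nat)) => snd (snd (snd p)))) by
      apply comp_snd, comp_snd, comp_snd, comp_id.
    apply comp_if; [now apply comp_eq0|apply comp_snd, comp_snd, comp_id|].
    apply comp_pair.
    + apply comp_app; [apply comp_raw, rec1_unsnd|].
      now apply comp_app; [apply comp_raw, rec1_pred|].
    + apply comp_app; [now apply comp_raw|].
      apply comp_cpair; [apply comp_fst, comp_id|apply comp_cpair; auto].
      apply comp_app; [apply comp_raw, rec1_unfst|].
      now apply comp_app; [apply comp_raw, rec1_pred|].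
  - now apply comp_raw. }
destruct Hg as (g & Hg & Eg). exists g. split; auto.
intros a. etransitivity; [exact (Eg (enc a))|]. cbv beta. rewrite El, Ec.
(* Generalised to any number of steps at least the length: the code 0 of the empty list stops the
   iteration, so surplus steps are harmless. *)
enough (Hit : forall k (bs : list B) (s : C), length bs <= k ->
  nat_rect (fun _ => (nat * nat)%type) (enc bs, enc s) (step (enc a)) k
    = (0, enc (fold_left (f a) bs s))).
{ rewrite Hit; auto. apply length_le_enc. }
induction k as [|k IH]; intros bs s Hk.
- destruct bs; [reflexivity|simpl in Hk; lia].
(* [nat_rect] exposes its last step, whereas the list is consumed from the front; this moves the
   first step out instead. *)
- assert (Hrot : forall s0, nat_rect (fun _ => (nat * nat)%type) s0 (step (enc a)) (S k)
      = nat_rect (fun _ => (nat * nat)%type) (step (enc a) 0 s0) (step (enc a)) k).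
  { clear. intros s0. induction k as [|k IH]; [reflexivity|].
    simpl in *. now rewrite IH. }
  rewrite Hrot. destruct bs as [|b bs].
  + apply (IH [] s). simpl; lia.
  + assert (Hst : step (enc a) 0 (enc (b :: bs), enc s) = (enc bs, enc (f a s b))).
    { unfold step. rewrite enc_cons. cbn [fst snd Nat.eqb Nat.pred].
      rewrite unfst_cpair, unsnd_cpair. f_equal. exact (Ef (a, (s, b))). }
    rewrite Hst. cbn [fold_left].
    apply IH. simpl in Hk; lia.
Qed.

Ltac comp_proj :=
  first [ apply comp_id | apply comp_fst; comp_proj | apply comp_snd; comp_proj ].

Lemma comp_rev {A B} `{Enc A} `{Enc B} (l : A -> list B) :
  computable l -> computable (fun a => rev (l a)).
Proof.
intros. apply computable_ext with (f := fun a => fold_left (fun r b => b :: r) (l a) []).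
{ intros a. rewrite <- fold_left_rev_right. generalize (rev (l a)).
  intros r; induction r; simpl; congruence. }
apply comp_fold_left; auto using comp_const. apply comp_cons; comp_proj.
Qed.

Lemma comp_fold_right {A B C} `{Enc A} `{Enc B} `{Enc C}
    (f : A -> B -> C -> C) (l : A -> list B) (c : A -> C) :
  computable (fun p : A * (B * C) => f (fst p) (fst (snd p)) (snd (snd p))) ->
  computable l -> computable c ->
  computable (fun a => fold_right (f a) (c a) (l a)).
Proof.
intros Hf Hl Hc.
apply computable_ext with (f := fun a => fold_left (fun s b => f a b s) (rev (l a)) (c a)).
{ intros a. now rewrite <- fold_left_rev_right, rev_involutive. }
apply comp_fold_left; auto using comp_rev.
apply (comp_app (fun p : A * (B * C) => f (fst p) (fst (snd p)) (snd (snd p)))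
   (fun p : A * (C * B) => (fst p, (snd (snd p), fst (snd p))))); auto.
apply comp_pair; [comp_proj|apply comp_pair; comp_proj].
Qed.

(** Adapts a loop body that ignores the accumulator to the shape expected by a fold. *)
Lemma comp_body2 {A B C D} `{Enc A} `{Enc B} `{Enc C} `{Enc D} (f : A -> B -> D) :
  computable (fun p : A * B => f (fst p) (snd p)) ->
  computable (fun p : A * (B * C) => f (fst p) (fst (snd p))).
Proof. intros Hf. apply (comp_app2 f); auto; comp_proj. Qed.

Lemma comp_app_list {A B} `{Enc A} `{Enc B} (f g : A -> list B) :
  computable f -> computable g -> computable (fun a => f a ++ g a).
Proof.
intros. apply computable_ext with (f := fun a => fold_right cons (g a) (f a)).
{ intros a. induction (f a); simpl; congruence. }
apply (comp_fold_right (fun _ => cons)); auto. apply comp_cons; comp_proj.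
Qed.

Lemma comp_map {A B C} `{Enc A} `{Enc B} `{Enc C} (f : A -> B -> C) (l : A -> list B) :
  computable (fun p : A * B => f (fst p) (snd p)) -> computable l ->
  computable (fun a => map (f a) (l a)).
Proof.
intros. apply computable_ext with
  (f := fun a => fold_right (fun b r => f a b :: r) [] (l a)).
{ intros a. induction (l a); simpl; congruence. }
apply comp_fold_right; auto using comp_const.
apply comp_cons; [now apply comp_body2|comp_proj].
Qed.

Lemma comp_flat_map {A B C} `{Enc A} `{Enc B} `{Enc C}
    (f : A -> B -> list C) (l : A -> list B) :
  computable (fun p : A * B => f (fst p) (snd p)) -> computable l ->
  computable (fun a => flat_map (f a) (l a)).
Proof.
intros. apply computable_ext with
  (f := fun a => fold_right (fun b r => f a b ++ r) [] (l a)).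
{ intros a. induction (l a); simpl; congruence. }
apply comp_fold_right; auto using comp_const.
apply comp_app_list; [now apply comp_body2|comp_proj].
Qed.

Lemma comp_existsb {A B} `{Enc A} `{Enc B} (f : A -> B -> bool) (l : A -> list B) :
  computable (fun p : A * B => f (fst p) (snd p)) -> computable l ->
  computable (fun a => existsb (f a) (l a)).
Proof.
intros. apply computable_ext with
  (f := fun a => fold_right (fun b r => f a b || r) false (l a)).
{ intros a. induction (l a); simpl; congruence. }
apply comp_fold_right; auto using comp_const.
apply comp_orb; [now apply comp_body2|comp_proj].
Qed.

Lemma comp_forallb {A B} `{Enc A} `{Enc B} (f : A -> B -> bool) (l : A -> list B) :
  computable (fun p : A * B => f (fst p) (snd p)) -> computable l ->
  computable (fun a => forallb (f a) (l a)).
Proof.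
intros. apply computable_ext with
  (f := fun a => fold_right (fun b r => f a b && r) true (l a)).
{ intros a. induction (l a); simpl; congruence. }
apply comp_fold_right; auto using comp_const.
apply comp_andb; [now apply comp_body2|comp_proj].
Qed.

Lemma comp_filter {A B} `{Enc A} `{Enc B} (f : A -> B -> bool) (l : A -> list B) :
  computable (fun p : A * B => f (fst p) (snd p)) -> computable l ->
  computable (fun a => filter (f a) (l a)).
Proof.
intros. apply computable_ext with
  (f := fun a => fold_right (fun b r => if f a b then b :: r else r) [] (l a)).
{ intros a. induction (l a) as [|b bs IH]; simpl; [|rewrite IH]; reflexivity. }
apply comp_fold_right; auto using comp_const.
apply comp_if; [now apply comp_body2|apply comp_cons; comp_proj|comp_proj].
Qed.

Lemma comp_length {A B} `{Enc A} `{Enc B} (l : A -> list B) :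
  computable l -> computable (fun a => length (l a)).
Proof.
intros. apply computable_ext with (f := fun a => fold_right (fun _ n => S n) 0 (l a)).
{ intros a. induction (l a); simpl; congruence. }
apply comp_fold_right; auto using comp_const. apply comp_S; comp_proj.
Qed.

Lemma comp_nth {A B} `{Enc A} `{Enc B} (k : A -> nat) (l : A -> list B) (d : A -> B) :
  computable k -> computable l -> computable d ->
  computable (fun a => nth (k a) (l a) (d a)).
Proof.
intros Hk Hl Hd.
assert (Htl : computable (fun l : list B => tl l)).
{ exists (fun n => unsnd (pred n)). split.
  - apply rec1_comp; auto using rec1_unsnd, rec1_pred.
  - intros [|b bs]; [reflexivity|]. rewrite enc_cons. apply unsnd_cpair. }
(* After [k a] tails have been taken, this fold returns the first remaining element, or the default
   if none is left. *)
apply computable_ext with (f := fun a => fold_right (fun b _ => b) (d a)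
  (nat_rect (fun _ => list B) (l a) (fun _ r => tl r) (k a))).
{ intros a. generalize (l a). induction (k a) as [|n IH]; intros bs.
  - now destruct bs.
  - assert (Hrot : nat_rect (fun _ => list B) bs (fun _ r => tl r) (S n)
      = nat_rect (fun _ => list B) (tl bs) (fun _ r => tl r) n).
    { clear. induction n as [|n IH]; [reflexivity|]. simpl in *. now rewrite IH. }
    rewrite Hrot, IH. destruct bs; [now destruct n|reflexivity]. }
apply comp_fold_right; auto.
- comp_proj.
- apply comp_nat_rect; auto. apply (comp_app (fun l => tl l)); auto. comp_proj.
Qed.

(** * Recursion on codes of terms and formulas *)


Fixpoint term_nested_ind (Q : term -> Prop) (HV : forall n, Q (Var n))
    (HF : forall f ts, Forall Q ts -> Q (Fn f ts)) (t : term) : Q t :=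
  match t with
  | Var n => HV n
  | Fn f ts => HF f ts
      ((fix all (l : list term) : Forall Q l :=
          match l with
          | [] => Forall_nil Q
          | u :: l' => Forall_cons u (term_nested_ind Q HV HF u) (all l')
          end) ts)
  end.

(** A common shape for substitution and for collecting function symbols, so that one computability
    proof serves both. *)
Fixpoint term_fold {B} (v : nat -> B) (g : nat -> list B -> B) (t : term) : B :=
  match t with
  | Var n => v n
  | Fn f ts => g f (map (term_fold v g) ts)
  end.

Fixpoint formula_fold {B} (fa : atom -> B) (fn : B -> B) (fc fd fi : B -> B -> B)
    (F : formula) : B :=
  let rec := formula_fold fa fn fc fd fi in
  match F with
  | FAtom a => fa a
  | FNot G => fn (rec G)
  | FAnd G H => fc (rec G) (rec H)
  | FOr G H => fd (rec G) (rec H)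
  | FImp G H => fi (rec G) (rec H)
  end.

(* Course-of-values recursion on [n] with parameter [e]: [G e n h] computes the
   value at [n] from the list [h] of the values at [n-1], ..., 0. *)
Definition history (G : nat -> nat -> list nat -> nat) (e n : nat) : list nat :=
  nat_rect (fun _ => list nat) [] (fun k h => G e k h :: h) n.

Definition cov (G : nat -> nat -> list nat -> nat) (e n : nat) : nat :=
  G e n (history G e n).

(** The latest value comes first, hence the reversed index [n - S k]. *)
Lemma nth_history G e n k :
  k < n -> nth (n - S k) (history G e n) 0 = cov G e k.
Proof.
induction n as [|n IH]; intros Hk; [lia|].
destruct (Nat.eq_dec k n) as [->|Hne].
- rewrite Nat.sub_diag. reflexivity.
- replace (S n - S k) with (S (n - S k)) by lia. apply IH. lia.
Qed.

Lemma comp_cov G :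
  computable (fun p : nat * (nat * list nat) => G (fst p) (fst (snd p)) (snd (snd p))) ->
  computable (fun p : nat * nat => cov G (fst p) (snd p)).
Proof.
intros HG.
apply (comp_app (fun p : nat * (nat * list nat) => G (fst p) (fst (snd p)) (snd (snd p)))
  (fun p : nat * nat => (fst p, (snd p, history G (fst p) (snd p))))); auto.
apply comp_pair; [comp_proj|apply comp_pair; [comp_proj|]].
apply comp_nat_rect; [apply comp_const| |comp_proj].
apply comp_cons; [|comp_proj].
apply (comp_app (fun p : nat * (nat * list nat) => G (fst p) (fst (snd p)) (snd (snd p)))
  (fun p : nat * nat * (nat * list nat) => (fst (fst p), (fst (snd p), snd (snd p))))); auto.
repeat (apply comp_pair; [comp_proj|]). comp_proj.
Qed.

Lemma comp_unfst {A} `{Enc A} (f : A -> nat) :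
  computable f -> computable (fun a => unfst (f a)).
Proof. apply comp_app, comp_raw, rec1_unfst. Qed.

Lemma comp_unsnd {A} `{Enc A} (f : A -> nat) :
  computable f -> computable (fun a => unsnd (f a)).
Proof. apply comp_app, comp_raw, rec1_unsnd. Qed.

Lemma enc_pair {A B} `{Enc A} `{Enc B} (a : A) (b : B) :
  enc (a, b) = cpair (enc a) (enc b).
Proof. reflexivity. Qed.

Lemma enc_Fn f ts : enc (Fn f ts) = cpair 1 (cpair f (enc ts)).
Proof. reflexivity. Qed.

Lemma lt_cpair_r a b : 0 < a -> b < cpair a b.
Proof. intros. rewrite cpair_tri. pose proof (tri_ge (a + b)). lia. Qed.

Lemma enc_In {A} `{Enc A} (a : A) l : In a l -> enc a < enc l.
Proof.
induction l as [|b l IH]; simpl; intros Ha; [easy|].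
rewrite enc_cons. pose proof (le_cpair_l (enc b) (enc l)).
pose proof (le_cpair_r (enc b) (enc l)).
destruct Ha as [->|Ha]; [|apply IH in Ha]; lia.
Qed.

(** Strict decrease, owed to the positive tag of [Fn], puts the values at all arguments into the
    history. *)
Lemma enc_arg_lt f ts t : In t ts -> enc t < enc (Fn f ts).
Proof.
intros Ht. apply enc_In in Ht. rewrite enc_Fn.
pose proof (le_cpair_r f (enc ts)).
pose proof (lt_cpair_r 1 (cpair f (enc ts))). lia.
Qed.

(** Allows the code of an argument list to be treated as a list of numbers without decoding its
    members. *)
Lemma enc_map_enc {A} `{Enc A} (l : list A) : enc (map enc l) = enc l.
Proof.
induction l as [|a l IH]; [reflexivity|]. simpl map. now rewrite !enc_cons, IH.
Qed.

(** Course-of-values recursion on the code of the term: the results for the arguments have smaller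
    indices and are read off the history. *)
Lemma comp_term_fold {A B} `{Enc A} `{Enc B}
    (v : A -> nat -> B) (g : A -> nat -> list B -> B) (t : A -> term) :
  computable (fun p : A * nat => v (fst p) (snd p)) ->
  computable (fun p : A * (nat * list B) => g (fst p) (fst (snd p)) (snd (snd p))) ->
  computable t ->
  computable (fun a => term_fold (v a) (g a) (t a)).
Proof.
intros (v' & Hv & Ev) (g' & Hg & Eg).
apply (comp_app2 (fun a u => term_fold (v a) (g a) u) (fun a => a)); [|apply comp_id].
(* [m] turns the codes of the arguments into the list of their values by looking each one up in the
   history. *)
destruct (comp_map (fun p c => nth (fst (fst p) - S c) (snd (fst p)) 0)
  (fun p : nat * list nat * list nat => snd p)) as (m & Hm & Em).
{ apply comp_nth; [apply comp_sub; [comp_proj|apply comp_S; comp_proj]|comp_proj|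
    apply comp_const]. }
{ comp_proj. }
set (G := fun (e n : nat) (h : list nat) =>
  if unfst n =? 0 then v' (cpair e (unsnd n))
  else g' (cpair e (cpair (unfst (unsnd n))
              (m (cpair (cpair n (enc h)) (unsnd (unsnd n))))))).
destruct (comp_cov G) as (r & Hr & Er).
{ unfold G. apply comp_if.
  - apply comp_eq0, comp_unfst. comp_proj.
  - apply comp_app; [now apply comp_raw|].
    apply comp_cpair; [comp_proj|apply comp_unsnd; comp_proj].
  - apply comp_app; [now apply comp_raw|].
    apply comp_cpair; [comp_proj|].
    apply comp_cpair; [apply comp_unfst, comp_unsnd; comp_proj|].
    apply comp_app; [now apply comp_raw|].
    apply comp_cpair; [apply comp_cpair; [comp_proj|apply comp_enc; comp_proj]|].
    apply comp_unsnd, comp_unsnd. comp_proj. }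
exists r. split; auto. intros [a u]. cbn [fst snd].
rewrite enc_pair. etransitivity; [exact (Er (enc a, enc u))|]. cbn [fst snd].
induction u as [n|f ts IH] using term_nested_ind.
- unfold cov, G at 1. change (enc (Var n)) with (cpair 0 n).
  rewrite unfst_cpair, unsnd_cpair. exact (Ev (a, n)).
- set (N := enc (Fn f ts)). unfold cov, G at 1.
  replace (unfst N) with 1 by (unfold N; now rewrite enc_Fn, unfst_cpair).
  replace (unsnd N) with (cpair f (enc ts)) by (unfold N; now rewrite enc_Fn, unsnd_cpair).
  rewrite unfst_cpair, unsnd_cpair. cbn [Nat.eqb].
  assert (El : m (cpair (cpair N (enc (history G (enc a) N))) (enc ts)) =
     enc (map (term_fold (v a) (g a)) ts)).
  { pose proof (Em ((N, history G (enc a) N), map enc ts)) as E1.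
    rewrite !enc_pair, enc_map_enc in E1. etransitivity; [exact E1|]. cbn [fst snd].
    rewrite <- (enc_map_enc (map (term_fold (v a) (g a)) ts)), !map_map.
    f_equal. apply map_ext_in. intros u Hu. cbn [fst snd].
    rewrite nth_history by now apply enc_arg_lt.
    rewrite Forall_forall in IH. now apply IH. }
  rewrite El. exact (Eg (a, (f, map (term_fold (v a) (g a)) ts))).
Qed.

Lemma comp_formula_fold {A B} `{Enc A} `{Enc B}
    (fa : A -> atom -> B) (fn : A -> B -> B) (fc fd fi : A -> B -> B -> B)
    (F : A -> formula) :
  computable (fun p : A * atom => fa (fst p) (snd p)) ->
  computable (fun p : A * B => fn (fst p) (snd p)) ->
  computable (fun p : A * (B * B) => fc (fst p) (fst (snd p)) (snd (snd p))) ->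
  computable (fun p : A * (B * B) => fd (fst p) (fst (snd p)) (snd (snd p))) ->
  computable (fun p : A * (B * B) => fi (fst p) (fst (snd p)) (snd (snd p))) ->
  computable F ->
  computable (fun a => formula_fold (fa a) (fn a) (fc a) (fd a) (fi a) (F a)).
Proof.
intros (fa' & Ha & Ea) (fn' & Hn & En) (fc' & Hc & Ec) (fd' & Hd & Ed) (fi' & Hi & Ei).
apply (comp_app2 (fun a => formula_fold (fa a) (fn a) (fc a) (fd a) (fi a)) (fun a => a));
  [|apply comp_id].
(* The same method as for terms: [look] fetches the value of one immediate subformula and [both]
   those of the two sides of a binary connective; [G] branches on the tag in the code. *)
set (look := fun (n : nat) (h : list nat) c => nth (n - S c) h 0).
set (both := fun (e n : nat) (h : list nat) => cpair e
  (cpair (look n h (unfst (unsnd n))) (look n h (unsnd (unsnd n))))).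
set (G := fun (e n : nat) (h : list nat) =>
  if unfst n =? 0 then fa' (cpair e (unsnd n))
  else if unfst n =? 1 then fn' (cpair e (look n h (unsnd n)))
  else if unfst n =? 2 then fc' (both e n h)
  else if unfst n =? 3 then fd' (both e n h)
  else fi' (both e n h)).
destruct (comp_cov G) as (r & Hr & Er).
{ unfold G.
  assert (Hu : computable (fun p : nat * (nat * list nat) => unfst (fst (snd p)))).
  { apply comp_unfst. comp_proj. }
  assert (Hl : forall f, computable f -> computable (fun p : nat * (nat * list nat) =>
    look (fst (snd p)) (snd (snd p)) (f p))).
  { intros f Hf. unfold look. apply comp_nth; [|comp_proj|apply comp_const].
    apply comp_sub; [comp_proj|now apply comp_S]. }
  assert (Hb : computable (fun p : nat * (nat * list nat) =>
    both (fst p) (fst (snd p)) (snd (snd p)))).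
  { unfold both. apply comp_cpair; [comp_proj|].
    apply comp_cpair; apply Hl; [apply comp_unfst|apply comp_unsnd];
      apply comp_unsnd; comp_proj. }
  repeat (apply comp_if; [apply comp_eqb; [exact Hu|apply comp_const]| |]);
    (apply comp_app; [now apply comp_raw|]); auto;
    (apply comp_cpair; [comp_proj|]).
  - apply comp_unsnd. comp_proj.
  - apply Hl, comp_unsnd. comp_proj. }
exists r. split; auto. intros [a K]. cbn [fst snd].
rewrite enc_pair. etransitivity; [exact (Er (enc a, enc K))|]. cbn [fst snd].
assert (Hlook : forall n k, k < n -> look n (history G (enc a) n) k = cov G (enc a) k)
  by (intros; now apply nth_history).
assert (Hboth : forall n t k l, 0 < t -> n = cpair t (cpair k l) ->
  both (enc a) n (history G (enc a) n) = cpair (enc a) (cpair (cov G (enc a) k) (cov G (enc a) l))).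
{ intros n t k l Ht ->. unfold both. rewrite unsnd_cpair, unfst_cpair, unsnd_cpair.
  pose proof (lt_cpair_r t (cpair k l) Ht).
  pose proof (le_cpair_l k l). pose proof (le_cpair_r k l).
  now rewrite !Hlook by lia. }
change (cov G (enc a) (enc K) = enc (formula_fold (fa a) (fn a) (fc a) (fd a) (fi a) K)).
induction K as [b|K IH|K IHK L IHL|K IHK L IHL|K IHK L IHL]; simpl formula_fold.
- unfold cov, G at 1. change (enc (FAtom b)) with (cpair 0 (enc b)).
  rewrite unfst_cpair, unsnd_cpair. exact (Ea (a, b)).
- unfold cov, G at 1. change (enc (FNot K)) with (cpair 1 (enc K)).
  rewrite unfst_cpair, unsnd_cpair. cbn [Nat.eqb].
  rewrite Hlook, IH by (apply lt_cpair_r; lia). apply (En (a, _)).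
- unfold cov, G at 1. change (enc (FAnd K L)) with (cpair 2 (cpair (enc K) (enc L))).
  rewrite unfst_cpair. cbn [Nat.eqb].
  rewrite (Hboth _ 2 (enc K) (enc L)), IHK, IHL by (reflexivity || lia).
  apply (Ec (a, (_, _))).
- unfold cov, G at 1. change (enc (FOr K L)) with (cpair 3 (cpair (enc K) (enc L))).
  rewrite unfst_cpair. cbn [Nat.eqb].
  rewrite (Hboth _ 3 (enc K) (enc L)), IHK, IHL by (reflexivity || lia).
  apply (Ed (a, (_, _))).
- unfold cov, G at 1. change (enc (FImp K L)) with (cpair 4 (cpair (enc K) (enc L))).
  rewrite unfst_cpair. cbn [Nat.eqb].
  rewrite (Hboth _ 4 (enc K) (enc L)), IHK, IHL by (reflexivity || lia).
  apply (Ei (a, (_, _))).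
Qed.

(** * The certificate test *)


Definition pred_of (a : atom) : nat := match a with At p _ => p end.
Definition args_of (a : atom) : list term := match a with At _ ts => ts end.
Definition is_neg (l : literal) : bool := match l with Pos _ => false | Neg _ => true end.

Lemma comp_atom_view {A} `{Enc A} (a : A -> atom) :
  computable a -> computable (fun x => (pred_of (a x), args_of (a x))).
Proof.
apply (comp_app (fun a => (pred_of a, args_of a))). apply comp_recode. now intros [].
Qed.

Lemma comp_pred_of {A} `{Enc A} (a : A -> atom) :
  computable a -> computable (fun x => pred_of (a x)).
Proof. intros Ha. exact (comp_fst _ (comp_atom_view _ Ha)). Qed.

Lemma comp_args_of {A} `{Enc A} (a : A -> atom) :
  computable a -> computable (fun x => args_of (a x)).
Proof. intros Ha. exact (comp_snd _ (comp_atom_view _ Ha)). Qed.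

Lemma comp_At {A} `{Enc A} (p : A -> nat) (ts : A -> list term) :
  computable p -> computable ts -> computable (fun x => At (p x) (ts x)).
Proof. apply comp_app2. now apply comp_recode. Qed.

Lemma comp_Fn {A} `{Enc A} (f : A -> nat) (ts : A -> list term) :
  computable f -> computable ts -> computable (fun x => Fn (f x) (ts x)).
Proof.
apply comp_app2. exists (fun n => cpair 1 n). split; [|reflexivity].
apply rec1_comp2; auto using rec2_cpair, rec1_const, rec1_id.
Qed.

(** The tag 0 or 1 in the code of a literal is the code of the boolean [is_neg], so the identity
    tracks this view. *)
Lemma comp_lit_view {A} `{Enc A} (l : A -> literal) :
  computable l -> computable (fun x => (is_neg (l x), atom_of_lit (l x))).
Proof.
apply (comp_app (fun l => (is_neg l, atom_of_lit l))). apply comp_recode. now intros [].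
Qed.

Lemma comp_is_neg {A} `{Enc A} (l : A -> literal) :
  computable l -> computable (fun x => is_neg (l x)).
Proof. intros Ha. exact (comp_fst _ (comp_lit_view _ Ha)). Qed.

Lemma comp_atom_of_lit {A} `{Enc A} (l : A -> literal) :
  computable l -> computable (fun x => atom_of_lit (l x)).
Proof. intros Ha. exact (comp_snd _ (comp_lit_view _ Ha)). Qed.

Lemma comp_lit {A} `{Enc A} (b : A -> bool) (a : A -> atom) :
  computable b -> computable a ->
  computable (fun x => if b x then Neg (a x) else Pos (a x)).
Proof.
apply (comp_app2 (fun (b : bool) a => if b then Neg a else Pos a)).
apply comp_recode. now intros [[] a'].
Qed.

Lemma comp_head {A} `{Enc A} (r : A -> rule) :
  computable r -> computable (fun x => head (r x)).
Proof.
intros Hr. refine (comp_fst (fun x => (head (r x), body (r x))) _).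
revert Hr. apply (comp_app (fun r => (head r, body r))). now apply comp_recode.
Qed.

Lemma comp_rule_body {A} `{Enc A} (r : A -> rule) :
  computable r -> computable (fun x => body (r x)).
Proof.
intros Hr. refine (comp_snd (fun x => (head (r x), body (r x))) _).
revert Hr. apply (comp_app (fun r => (head r, body r))). now apply comp_recode.
Qed.

Lemma comp_mkRule {A} `{Enc A} (h : A -> list atom) (b : A -> list literal) :
  computable h -> computable b -> computable (fun x => mkRule (h x) (b x)).
Proof. apply comp_app2. now apply comp_recode. Qed.

(** A hook, redefined below, through which [comp] learns further closure lemmas. *)
Ltac comp_user := fail.

Ltac comp :=
  cbv beta; try assumption;
  lazymatch goal with
  | |- computable (fun _ => ?c) => apply comp_const
  | |- computable (fun a => a) => apply comp_id
  | |- computable fst => apply (comp_fst (fun a => a)), comp_id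
  | |- computable snd => apply (comp_snd (fun a => a)), comp_id
  | |- computable (fun a => fst _) => apply comp_fst; comp
  | |- computable (fun a => snd _) => apply comp_snd; comp
  | |- computable (fun a => (_, _)) => apply comp_pair; comp
  | |- computable (fun a => enc _) => apply comp_enc; comp
  | |- computable (fun a => S _) => apply comp_S; comp
  | |- computable (fun a => _ =? _) => apply comp_eqb; comp
  | |- computable (fun a => negb _) => apply comp_negb; comp
  | |- computable (fun a => _ && _) => apply comp_andb; comp
  | |- computable (fun a => _ || _) => apply comp_orb; comp
  | |- computable (fun a => implb _ _) => apply comp_implb; comp
  | |- computable (fun a => _ :: _) => apply comp_cons; comp
  | |- computable (fun a => _ ++ _) => apply comp_app_list; comp
  | |- computable (fun a => map _ _) => apply comp_map; comp
  | |- computable (fun a => flat_map _ _) => apply comp_flat_map; comp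
  | |- computable (fun a => filter _ _) => apply comp_filter; comp
  | |- computable (fun a => existsb _ _) => apply comp_existsb; comp
  | |- computable (fun a => forallb _ _) => apply comp_forallb; comp
  | |- computable (fun a => fold_right _ _ _) => apply comp_fold_right; comp
  | |- computable (fun a => nat_rect _ _ _ _) => apply comp_nat_rect; comp
  | |- computable (fun a => length _) => apply comp_length; comp
  | |- computable (fun a => nth _ _ _) => apply comp_nth; comp
  | |- computable (fun a => term_fold _ _ _) => apply comp_term_fold; comp
  | |- computable (fun a => formula_fold _ _ _ _ _ _) => apply comp_formula_fold; comp
  | |- computable (fun a => pred_of _) => apply comp_pred_of; comp
  | |- computable (fun a => args_of _) => apply comp_args_of; comp
  | |- computable (fun a => At _ _) => apply comp_At; comp
  | |- computable (fun a => Fn _ _) => apply comp_Fn; comp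
  | |- computable (fun a => is_neg _) => apply comp_is_neg; comp
  | |- computable (fun a => atom_of_lit _) => apply comp_atom_of_lit; comp
  | |- computable (fun a => head _) => apply comp_head; comp
  | |- computable (fun a => body _) => apply comp_rule_body; comp
  | |- computable (fun a => mkRule _ _) => apply comp_mkRule; comp
  | |- computable (fun a => if is_neg _ then Neg _ else Pos _) => apply comp_lit; comp
  | |- computable (fun a => if _ then _ else _) => apply comp_if; comp
  | Hf : computable ?f |- computable (fun a => ?f _) => apply (comp_app f); comp
  | |- _ => comp_user; comp
  end.

(** * Substitutions as finite lists, and the computability of rule instances and signatures *)

Definition subst_of (l : list term) (n : nat) : term := nth n l (Var 0).

Lemma subst_term_fold s t : subst_term s t = term_fold s Fn t.
Proof.
induction t as [n|f ts IH] using term_nested_ind; [reflexivity|]. simpl. f_equal.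
now apply map_ext_Forall.
Qed.

Lemma comp_subst_atom {A} `{Enc A} (s : A -> list term) (a : A -> atom) :
  computable s -> computable a ->
  computable (fun x => subst_atom (subst_of (s x)) (a x)).
Proof.
intros Hs Ha. apply computable_ext with (f := fun x =>
  At (pred_of (a x)) (map (fun t => term_fold (subst_of (s x)) Fn t) (args_of (a x)))).
{ intros x. destruct (a x) as [p ts]. simpl. f_equal. apply map_ext.
  intros t. symmetry. apply subst_term_fold. }
unfold subst_of. comp.
Qed.

Ltac comp_user ::= lazymatch goal with
  | |- computable (fun a => subst_atom _ _) => apply comp_subst_atom
  end.

Lemma comp_subst_rule {A} `{Enc A} (s : A -> list term) (r : A -> rule) :
  computable s -> computable r ->
  computable (fun x => subst_rule (subst_of (s x)) (r x)).
Proof.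
intros Hs Ha. apply computable_ext with (f := fun x =>
  mkRule (map (fun a => subst_atom (subst_of (s x)) a) (head (r x)))
    (map (fun l => if is_neg l then Neg (subst_atom (subst_of (s x)) (atom_of_lit l))
                   else Pos (subst_atom (subst_of (s x)) (atom_of_lit l))) (body (r x)))).
{ intros x. unfold subst_rule. f_equal. apply map_ext. now intros []. }
comp.
Qed.

Lemma comp_atoms_of_rule {A} `{Enc A} (r : A -> rule) :
  computable r -> computable (fun x => atoms_of_rule (r x)).
Proof. intros Hr. unfold atoms_of_rule. comp. Qed.

Lemma comp_pos_body {A} `{Enc A} (r : A -> rule) :
  computable r -> computable (fun x => pos_body (r x)).
Proof.
intros Hr. apply computable_ext with (f := fun x =>
  flat_map (fun l => if is_neg l then [] else [atom_of_lit l]) (body (r x))).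
{ intros x. unfold pos_body. apply flat_map_ext. now intros []. }
comp.
Qed.

Definition term_funs (t : term) : list (nat * nat) :=
  term_fold (fun _ => []) (fun f rs => (f, length rs) :: flat_map (fun r => r) rs) t.

Lemma funs_term_fold t : funs_term t = term_funs t.
Proof.
induction t as [n|f ts IH] using term_nested_ind; [reflexivity|].
unfold term_funs in *. simpl. rewrite length_map. f_equal.
induction IH; simpl; [reflexivity|]. congruence.
Qed.

Lemma comp_funs_prog {A} `{Enc A} (P : A -> program) :
  computable P -> computable (fun x => funs_prog (P x)).
Proof.
intros HP. apply computable_ext with (f := fun x => flat_map (fun r =>
  flat_map (fun a => flat_map (fun t => term_funs t) (args_of a))
    (head r ++ map atom_of_lit (body r))) (P x)).
{ intros x. apply flat_map_ext. intros r. apply flat_map_ext. intros [p ts].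
  apply flat_map_ext. intros t. symmetry. apply funs_term_fold. }
unfold term_funs. comp.
Qed.

Lemma comp_preds_prog {A} `{Enc A} (P : A -> program) :
  computable P -> computable (fun x => preds_prog (P x)).
Proof.
intros HP. apply computable_ext with (f := fun x => flat_map (fun r =>
  map (fun a => (pred_of a, length (args_of a))) (head r ++ map atom_of_lit (body r))) (P x)).
{ intros x. apply flat_map_ext. intros r. apply map_ext. now intros []. }
comp.
Qed.

Ltac comp_user ::= lazymatch goal with
  | |- computable (fun a => subst_rule _ _) => apply comp_subst_rule
  | |- computable (fun a => atoms_of_rule _) => apply comp_atoms_of_rule
  | |- computable (fun a => pos_body _) => apply comp_pos_body
  | |- computable (fun a => funs_prog _) => apply comp_funs_prog
  | |- computable (fun a => preds_prog _) => apply comp_preds_prog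
  end.

(** * Finite enumerations and the boolean test built on them *)

Definition tuples {A} (l : list A) (k : nat) : list (list A) :=
  nat_rect (fun _ => list (list A)) [[]]
    (fun _ ts => flat_map (fun a => map (fun t => a :: t) ts) l) k.

Definition sublists {A} (l : list A) : list (list A) :=
  fold_right (fun a ss => ss ++ map (fun s => a :: s) ss) [[]] l.

(** Level 0 is empty, so constants first appear at level 1. The recursor is used in place of a
    fixpoint so that [comp] recognises it. *)
Definition level (sig : list (nat * nat)) (n : nat) : list term :=
  nat_rect (fun _ => list term) []
    (fun _ ts => flat_map (fun fk => map (fun us => Fn (fst fk) us) (tuples ts (snd fk))) sig) n.

Definition base_level (P : program) (n : nat) : list atom :=
  flat_map (fun pk => map (fun us => At (fst pk) us)
              (tuples (level (herbrand_funs P) n) (snd pk))) (preds_prog P).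

(* Variables of [r] have indices at most the code of [r], so the entries of a
   tuple of length [S (enc r)] determine an instance of [r]. *)
Definition instances (P : program) (n : nat) : list rule :=
  flat_map (fun r => map (fun us => subst_rule (subst_of us) r)
              (tuples (level (herbrand_funs P) n) (S (enc r)))) P.

Definition mem (a : atom) (l : list atom) : bool :=
  existsb (fun b => enc a =? enc b) l.

Definition meets (U : list atom) (g : rule) : bool :=
  existsb (fun a => mem a U) (head g).

Definition closedb (R : list rule) (U : list atom) : bool :=
  forallb (fun g => implb (meets U g) (forallb (fun a => mem a U) (atoms_of_rule g))) R.

(** [M] determines the reduct and [N] is the interpretation tested; a rule with a negated atom in
    [M] is deleted and so counts as satisfied. *)
Definition satb (M N : list atom) (g : rule) : bool :=
  existsb (fun l => is_neg l && mem (atom_of_lit l) M) (body g)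
  || (implb (forallb (fun a => mem a N) (pos_body g)) (meets N g)).

Definition stableb (R : list rule) (M : list atom) : bool :=
  forallb (fun g => satb M M g) R &&
  forallb (fun N => implb (forallb (fun g => satb M N g) R) (forallb (fun a => mem a N) M))
    (sublists M).

Definition coversb (U : list atom) (F : formula) : bool :=
  formula_fold (fun a => mem a U) (fun b => b) (fun b c => b && c) (fun b c => b && c)
    (fun b c => b && c) F.

Definition holdsb (M : list atom) (F : formula) : bool :=
  formula_fold (fun a => mem a M) (fun b => negb b) (fun b c => b && c)
    (fun b c => b || c) (fun b c => implb b c) F.

(** Rule instances are taken one level above the atoms of [U]; the extra level provides the deep
    term on which [ground_rule_instance] relies. *)
Definition check (P : program) (F : formula) (n : nat) : bool :=
  existsb (fun U =>
    coversb U F && closedb (instances P (S n)) U &&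
    forallb (fun M =>
        implb (stableb (filter (fun g => meets U g) (instances P (S n))) M) (holdsb M F))
      (sublists U))
    (sublists (base_level P n)).

Lemma comp_check :
  computable (fun p : (program * formula) * nat => check (fst (fst p)) (snd (fst p)) (snd p)).
Proof.
unfold check, base_level, instances, closedb, stableb, satb, coversb, holdsb, meets, mem,
  sublists, level, tuples, herbrand_funs.
comp.
Qed.

(** * Correctness of the certificate test *)


(** Injectivity is required only at the members of [l], so that the lemma can be applied to an
    induction hypothesis on subterms. *)
Lemma enc_list_inj {A} `{Enc A} (l l' : list A) :
  Forall (fun a => forall b, enc a = enc b -> a = b) l -> enc l = enc l' -> l = l'.
Proof.
intros Hl. revert l'. induction Hl as [|a l Ha Hl IH]; intros [|b l'] E; try discriminate; auto.
rewrite !enc_cons in E. injection E as E. apply cpair_inj in E as [E1 E2].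
f_equal; auto.
Qed.

Lemma enc_term_inj (t u : term) : enc t = enc u -> t = u.
Proof.
revert u. induction t as [n|f ts IH] using term_nested_ind; intros [m|g us] E;
  apply cpair_inj in E as [E1 E2]; try discriminate; [congruence|].
apply cpair_inj in E2 as [-> E2]. f_equal. now apply enc_list_inj.
Qed.

Lemma enc_atom_inj (a b : atom) : enc a = enc b -> a = b.
Proof.
destruct a as [p ts], b as [q us]. intros E. apply cpair_inj in E as [-> E].
f_equal. apply enc_list_inj; auto. apply Forall_forall. intros t _. apply enc_term_inj.
Qed.

Lemma mem_spec a l : mem a l = true <-> In a l.
Proof.
unfold mem. rewrite existsb_exists. split.
- intros (b & Hb & E). apply Nat.eqb_eq, enc_atom_inj in E. now subst.
- intros Ha. exists a. now rewrite Nat.eqb_refl.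
Qed.

Lemma forallb_mem l U : forallb (fun a => mem a U) l = true <-> incl l U.
Proof.
rewrite forallb_forall. unfold incl. split; intros Hl a Ha; apply mem_spec, Hl, Ha.
Qed.

Lemma meets_spec U g : meets U g = true <-> exists a, In a (head g) /\ In a U.
Proof.
unfold meets. rewrite existsb_exists. split; intros (a & Ha & Hb); exists a;
  split; auto; now apply mem_spec.
Qed.

Lemma implb_spec b c : implb b c = true <-> (b = true -> c = true).
Proof. destruct b, c; simpl; intuition congruence. Qed.

(** * What the enumerations contain: tuples, sublists, and levels of ground terms *)

Lemma In_tuples {A} (l : list A) k t :
  In t (tuples l k) <-> length t = k /\ Forall (fun a => In a l) t.
Proof.
revert t. induction k as [|k IH]; intros t; simpl.
- split; [intros [<-|[]]; auto|]. intros [E _]. destruct t; [auto|discriminate].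
- rewrite in_flat_map. split.
  + intros (a & Ha & Ht). apply in_map_iff in Ht as (u & <- & Hu).
    apply IH in Hu as [<- Hu]. auto.
  + intros [E Ht]. destruct Ht as [|a u Ha Hu]; [discriminate|].
    injection E as E. exists a. split; auto. apply in_map, IH. auto.
Qed.

Lemma sublists_incl {A} (l s : list A) : In s (sublists l) -> incl s l.
Proof.
revert s. induction l as [|a l IH]; intros s; simpl.
- intros [<-|[]]. apply incl_refl.
- rewrite in_app_iff, in_map_iff. intros [Hs|(u & <- & Hu)].
  + now apply incl_tl, IH.
  + apply incl_cons; [now left|]. now apply incl_tl, IH.
Qed.

Lemma filter_sublists {A} (p : A -> bool) l : In (filter p l) (sublists l).
Proof.
induction l as [|a l IH]; simpl; [auto|]. rewrite in_app_iff.
destruct (p a); [right; now apply in_map|now left].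
Qed.

(** By excluded middle, an arbitrary and possibly undecidable interpretation is matched on a finite
    set by one of the enumerated candidates. *)
Lemma sublists_select {A} (Q : A -> Prop) (l : list A) :
  exists s, In s (sublists l) /\ forall a, In a s <-> In a l /\ Q a.
Proof.
exists (filter (fun a => if excluded_middle_informative (Q a) then true else false) l).
split; [apply filter_sublists|]. intros a. rewrite filter_In.
destruct (excluded_middle_informative (Q a)); intuition discriminate.
Qed.

Lemma In_level_S sig n t : In t (level sig (S n)) <->
  exists f us, t = Fn f us /\ In (f, length us) sig /\ Forall (fun u => In u (level sig n)) us.
Proof.
simpl. rewrite in_flat_map. split.
- intros ([f k] & Hf & Ht). apply in_map_iff in Ht as (us & <- & Hu).
  cbn [fst snd] in Hu. apply In_tuples in Hu as [<- Hu]. eauto.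
- intros (f & us & -> & Hf & Hu). exists (f, length us). split; auto.
  apply in_map, In_tuples. auto.
Qed.

Lemma level_S_incl sig n : incl (level sig n) (level sig (S n)).
Proof.
induction n as [|n IH]; [easy|]. intros t Ht. apply In_level_S in Ht as (f & us & -> & Hf & Hu).
apply In_level_S. exists f, us. repeat split; auto. eapply Forall_impl; [|exact Hu]. exact IH.
Qed.

Lemma level_incl sig m n : m <= n -> incl (level sig m) (level sig n).
Proof.
induction 1; [apply incl_refl|]. eapply incl_tran; [eassumption|apply level_S_incl].
Qed.

Lemma level_args sig n f us : In (Fn f us) (level sig n) -> Forall (fun u => In u (level sig n)) us.
Proof.
destruct n as [|n]; [easy|]. intros Ht. apply In_level_S in Ht as (g & ws & E & _ & Hu).
injection E as <- <-. eapply Forall_impl; [|exact Hu]. apply level_S_incl.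
Qed.

(** Monotonicity allows finitely many bounds to be replaced by their maximum. *)
Lemma Forall_In_bound {A} (Q : nat -> A -> Prop) (l : list A) :
  (forall m n a, m <= n -> Q m a -> Q n a) ->
  Forall (fun a => exists n, Q n a) l -> exists n, Forall (Q n) l.
Proof.
intros Hmono. induction 1 as [|a l [m Hm] _ [n Hn]]; [now exists 0|].
exists (max m n). constructor; [apply (Hmono m); auto; lia|].
eapply Forall_impl; [|exact Hn]. intros b. apply Hmono. lia.
Qed.

Lemma term_in_Fn sig f ts :
  term_in sig (Fn f ts) <-> In (f, length ts) sig /\ Forall (term_in sig) ts.
Proof.
simpl. apply and_iff_compat_l. induction ts as [|t ts IH]; [easy|].
rewrite Forall_cons_iff. now apply and_iff_compat_l.
Qed.

Lemma term_in_level sig t : term_in sig t <-> exists n, In t (level sig n).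
Proof.
split.
- induction t as [n|f ts IH] using term_nested_ind; [easy|].
  intros Ht. apply term_in_Fn in Ht as [Hf Ht].
  destruct (Forall_In_bound (fun n u => In u (level sig n)) ts) as [n Hn].
  { intros m n u Hmn. now apply level_incl. }
  { rewrite Forall_forall in *. auto. }
  exists (S n). apply In_level_S. eauto.
- intros [n Hn]. revert t Hn. induction n as [|n IH]; [easy|]. intros t Ht.
  apply In_level_S in Ht as (f & us & -> & Hf & Hu). apply term_in_Fn. split; auto.
  eapply Forall_impl; [|exact Hu]. exact IH.
Qed.

Lemma term_in_ground sig t : term_in sig t -> term_ground t.
Proof.
induction t as [n|f ts IH] using term_nested_ind; [easy|]. intros Ht.
apply term_in_Fn in Ht as [_ Ht]. simpl. induction Ht as [|u us Hu Hus IHus]; [easy|].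
apply Forall_cons_iff in IH as [IHu IH]. split; [exact (IHu Hu)|exact (IHus IH)].
Qed.

Lemma herbrand_ground P a : herbrand_atom P a -> ground_atom a.
Proof.
destruct a as [p ts]. intros [_ Ht]. eapply Forall_impl; [|exact Ht]. intros t. apply term_in_ground.
Qed.

(** As [L] is closed under arguments, the value of every variable occurring in [t] lies in [L],
    where [s] and [s'] agree. *)
Lemma subst_term_stable (L : term -> Prop) (s s' : nat -> term) t :
  (forall f us, L (Fn f us) -> Forall L us) ->
  (forall n, L (s n) -> s' n = s n) ->
  L (subst_term s t) -> subst_term s' t = subst_term s t.
Proof.
intros HL Hs. induction t as [n|f ts IH] using term_nested_ind; simpl; auto.
intros Ht. apply HL in Ht. rewrite Forall_map in Ht. f_equal.
apply map_ext_Forall. rewrite Forall_forall in *. auto.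
Qed.

Lemma subst_atom_stable (L : term -> Prop) (s s' : nat -> term) a :
  (forall f us, L (Fn f us) -> Forall L us) ->
  (forall n, L (s n) -> s' n = s n) ->
  Forall L (args_of (subst_atom s a)) -> subst_atom s' a = subst_atom s a.
Proof.
intros HL Hs. destruct a as [p ts]. simpl. intros Ht. rewrite Forall_map in Ht. f_equal.
apply map_ext_Forall. eapply Forall_impl; [|exact Ht]. intros t.
now apply subst_term_stable.
Qed.

Lemma subst_rule_ext s s' r :
  (forall a, In a (atoms_of_rule r) -> subst_atom s a = subst_atom s' a) ->
  subst_rule s r = subst_rule s' r.
Proof.
intros E. unfold atoms_of_rule in E. unfold subst_rule. f_equal; apply map_ext_in.
- intros a Ha. apply E, in_or_app. now left.
- intros l Hl. assert (subst_atom s (atom_of_lit l) = subst_atom s' (atom_of_lit l)).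
  { apply E, in_or_app. right. now apply in_map. }
  destruct l; simpl in *; congruence.
Qed.

Lemma atoms_subst_rule s r :
  atoms_of_rule (subst_rule s r) = map (subst_atom s) (atoms_of_rule r).
Proof.
unfold atoms_of_rule. simpl. rewrite map_app, !map_map. f_equal.
apply map_ext. now intros [].
Qed.

(** The index of a variable never exceeds the code of a term containing it. *)
Lemma subst_term_ext_enc s s' t :
  (forall n, n <= enc t -> s n = s' n) -> subst_term s t = subst_term s' t.
Proof.
induction t as [n|f ts IH] using term_nested_ind; simpl; intros E.
- apply E, le_cpair_r.
- f_equal. apply map_ext_in. intros u Hu. rewrite Forall_forall in IH. apply IH; auto.
  intros n Hn. apply E. pose proof (enc_arg_lt f ts u Hu). lia.
Qed.

Lemma enc_atom_of_rule a r : In a (atoms_of_rule r) -> enc a <= enc r.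
Proof.
intros Ha. unfold atoms_of_rule in Ha.
pose proof (le_cpair_l (enc (head r)) (enc (body r))).
pose proof (le_cpair_r (enc (head r)) (enc (body r))).
change (enc r) with (cpair (enc (head r)) (enc (body r))).
apply in_app_or in Ha as [Ha|Ha].
- apply enc_In in Ha. lia.
- apply in_map_iff in Ha as (l & <- & Hl). apply enc_In in Hl.
  assert (enc (atom_of_lit l) <= enc l) by (destruct l; apply le_cpair_r). lia.
Qed.

Lemma subst_rule_ext_enc s s' r :
  (forall n, n <= enc r -> s n = s' n) -> subst_rule s r = subst_rule s' r.
Proof.
intros E. apply subst_rule_ext. intros [p ts] Ha. apply enc_atom_of_rule in Ha.
simpl. f_equal. apply map_ext_in. intros t Ht. apply subst_term_ext_enc.
intros n Hn. apply E. apply enc_In in Ht.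
pose proof (le_cpair_r p (enc ts)).
change (enc (At p ts)) with (cpair p (enc ts)) in Ha. lia.
Qed.

Lemma herbrand_constant P : exists t, herbrand_term P t.
Proof.
assert (exists f, In (f, 0) (herbrand_funs P)) as [f Hf].
{ unfold herbrand_funs. destruct (existsb _ _) eqn:E.
  - apply existsb_exists in E as ([f k] & Hf & Hk). apply Nat.eqb_eq in Hk. simpl in Hk.
    subst. eauto.
  - exists 0. now left. }
exists (Fn f []). apply term_in_Fn. auto.
Qed.

Lemma In_instances P n s r :
  In r P -> (forall k, In (s k) (level (herbrand_funs P) n)) ->
  In (subst_rule s r) (instances P n).
Proof.
intros Hr Hs. apply in_flat_map. exists r. split; auto. apply in_map_iff.
(* The tuple tabulates [s] on all indices up to the code of [r], which covers its variables. *)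
exists (map s (seq 0 (S (enc r)))). split.
- apply subst_rule_ext_enc. intros k Hk. unfold subst_of.
  rewrite nth_indep with (d' := s 0) by (rewrite length_map, length_seq; lia).
  rewrite map_nth, seq_nth; [reflexivity|lia].
- apply In_tuples. rewrite length_map, length_seq. split; auto.
  apply Forall_map, Forall_forall. auto.
Qed.

Lemma instances_ground P n g : In g (instances P n) -> ground_rule P g.
Proof.
intros Hg. apply in_flat_map in Hg as (r & Hr & Hg).
apply in_map_iff in Hg as (us & <- & Hu). apply In_tuples in Hu as [El Hu].
destruct (herbrand_constant P) as [c Hc].
(* The default [Var 0] is exchanged for a Herbrand term, making the substitution ground at every
   index; the variables of [r] lie within the tuple and do not notice. *)
exists r, (fun k => nth k us c). repeat split; auto.
- intros k. destruct (nth_in_or_default k us c) as [Hk| ->]; auto.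
  rewrite Forall_forall in Hu. apply term_in_level. eauto.
- apply subst_rule_ext_enc. intros k Hk. apply nth_indep. lia.
Qed.

Definition closed (P : program) (U : atom -> Prop) : Prop :=
  forall g, ground_rule P g -> (exists a, In a (head g) /\ U a) ->
    forall b, In b (atoms_of_rule g) -> U b.

Lemma In_base_level P n a : In a (base_level P n) <->
  In (pred_of a, length (args_of a)) (preds_prog P) /\
  Forall (fun t => In t (level (herbrand_funs P) n)) (args_of a).
Proof.
unfold base_level. rewrite in_flat_map. split.
- intros ([p k] & Hp & Ha). apply in_map_iff in Ha as (us & <- & Hu).
  cbn [fst snd] in Hu. apply In_tuples in Hu as [<- Hu]. auto.
- destruct a as [p ts]. intros [Hp Ht]. exists (p, length ts). split; auto.
  apply in_map, In_tuples. auto.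
Qed.

Lemma herbrand_base_level P a : herbrand_atom P a <-> exists n, In a (base_level P n).
Proof.
destruct a as [p ts]. split.
- intros [Hp Ht].
  destruct (Forall_In_bound (fun n u => In u (level (herbrand_funs P) n)) ts) as [n Hn].
  { intros m n u Hmn. now apply level_incl. }
  { eapply Forall_impl; [|exact Ht]. intros t. apply (term_in_level (herbrand_funs P)). }
  exists n. now apply In_base_level.
- intros [n Hn]. apply In_base_level in Hn as [Hp Ht]. split; auto.
  eapply Forall_impl; [|exact Ht]. intros t Ht'. apply (proj2 (term_in_level (herbrand_funs P) t)). now exists n.
Qed.

Lemma base_level_incl P m n : m <= n -> incl (base_level P m) (base_level P n).
Proof.
intros Hmn a Ha. apply In_base_level in Ha as [Hp Ht]. apply In_base_level. split; auto.
eapply Forall_impl; [|exact Ht]. now apply level_incl.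
Qed.

Lemma closedb_spec P n U :
  closedb (instances P n) U = true <->
  forall g, In g (instances P n) -> (exists a, In a (head g) /\ In a U) ->
    incl (atoms_of_rule g) U.
Proof.
unfold closedb. rewrite forallb_forall. split; intros HU g Hg; specialize (HU g Hg).
- rewrite implb_spec, meets_spec, forallb_mem in HU. exact HU.
- now rewrite implb_spec, meets_spec, forallb_mem.
Qed.

(* If some term [c] has level exactly [S n], replacing by [c] the values of [s]
   outside level [n] does not change the head atom of [subst_rule s r] lying in [U];
   the new instance is then inside [U], hence avoids [c], hence is the old one.
   If there is no such [c], all Herbrand terms have level [n]. *)
Lemma ground_rule_instance P n U g :
  closedb (instances P (S n)) U = true -> incl U (base_level P n) ->
  ground_rule P g -> (exists a, In a (head g) /\ In a U) -> In g (instances P (S n)).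
Proof.
intros HU HUn (r & s & Hr & Hs & ->) (a & Ha & HaU).
set (sig := herbrand_funs P) in *.
pose proof (proj1 (closedb_spec P (S n) U) HU) as Hcl.
destruct (classic (exists c, In c (level sig (S n)) /\ ~ In c (level sig n)))
  as [(c & Hc & Hcn)|Hno].
- set (s' := fun k => if excluded_middle_informative (In (s k) (level sig n))
                      then s k else c).
  assert (Hs' : forall k, In (s' k) (level sig (S n))).
  { intros k. unfold s'. destruct (excluded_middle_informative _); auto.
    now apply level_S_incl. }
  assert (Hi : In (subst_rule s' r) (instances P (S n))) by now apply In_instances.
  apply in_map_iff in Ha as (h & <- & Hh).
  assert (Eh : subst_atom s' h = subst_atom s h).
  { apply (subst_atom_stable (fun t => In t (level sig n))).
    - apply level_args.
    - intros k Hk. unfold s'. now destruct (excluded_middle_informative _).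
    - now apply In_base_level, HUn. }
  replace (subst_rule s r) with (subst_rule s' r); auto.
  symmetry. apply subst_rule_ext. intros b Hb.
  apply (subst_atom_stable (fun t => In t (level sig n))).
  + apply level_args.
  + intros k. unfold s'. now destruct (excluded_middle_informative _).
  + apply In_base_level, HUn, (Hcl _ Hi).
    * exists (subst_atom s h). split; auto. rewrite <- Eh. now apply in_map.
    * rewrite atoms_subst_rule. now apply in_map.
- apply In_instances; auto. intros k. apply level_S_incl.
  generalize (Hs k). generalize (s k). intros t.
  induction t as [m|f ts IH] using term_nested_ind; [easy|]. intros Ht.
  apply term_in_Fn in Ht as [Hf Ht]. apply NNPP. intros Hn. apply Hno.
  exists (Fn f ts). split; auto. apply In_level_S. exists f, ts. repeat split; auto.
  rewrite Forall_forall in *. intros u Hu. exact (IH u Hu (Ht u Hu)).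
Qed.

Lemma closedb_closed P n U :
  closedb (instances P (S n)) U = true -> incl U (base_level P n) ->
  closed P (fun a => In a U).
Proof.
intros HU HUn g Hg Hm b Hb.
exact (proj1 (closedb_spec P (S n) U) HU g (ground_rule_instance P n U g HU HUn Hg Hm) Hm b Hb).
Qed.

Lemma closed_closedb P n U :
  closed P (fun a => In a U) -> closedb (instances P n) U = true.
Proof.
intros HU. apply closedb_spec. intros g Hg Hm b Hb.
apply instances_ground in Hg. exact (HU g Hg Hm b Hb).
Qed.

(** * Stability relative to a set of head atoms, and its agreement with the boolean test *)

Definition sat (M N : interp) (g : rule) : Prop :=
  (forall b, In (Neg b) (body g) -> ~ M b) ->
  (forall a, In a (pos_body g) -> N a) -> exists a, In a (head g) /\ N a.

Definition stable_on (P : program) (U M : interp) : Prop :=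
  let R g := ground_rule P g /\ exists a, In a (head g) /\ U a in
  (forall a, M a -> U a) /\
  (forall g, R g -> sat M M g) /\
  forall N : interp, (forall a, N a -> M a) -> (forall g, R g -> sat M N g) ->
    forall a, M a -> N a.

Lemma satb_spec M N g :
  satb M N g = true <-> sat (fun a => In a M) (fun a => In a N) g.
Proof.
unfold satb, sat. rewrite orb_true_iff, implb_spec, forallb_mem, meets_spec, existsb_exists.
split.
- intros [(l & Hl & E)|E] Hneg; auto.
  apply andb_true_iff in E as [E1 E2]. apply mem_spec in E2.
  destruct l as [b|b]; [discriminate|]. now destruct (Hneg b).
- intros Hs. destruct (classic (exists b, In (Neg b) (body g) /\ In b M)) as [(b & Hb & Hm)|Hno].
  + left. exists (Neg b). split; auto. now apply mem_spec.
  + right. apply Hs. intros b Hb Hm. eauto.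
Qed.

Lemma stable_on_ext P (U V M N : interp) :
  (forall a, U a <-> V a) -> (forall a, M a <-> N a) -> stable_on P U M -> stable_on P V N.
Proof.
intros EU EM (H1 & H2 & H3). split; [|split].
- intros a Ha. apply EU, H1, EM, Ha.
- intros g (Hg & a & Ha & Hb) Hn Hp.
  destruct (H2 g) as (c & Hc & Hd).
  + split; auto. exists a. split; auto. now apply EU.
  + intros b Hb'. rewrite EM. auto.
  + intros b Hb'. apply EM. auto.
  + exists c. split; auto. now apply EM.
- intros K HK HS a Ha. apply H3; [intros b Hb; now apply EM, HK| |now apply EM].
  intros g (Hg & b & Hb & Hb') Hn Hp. apply HS; auto.
  + split; auto. exists b. split; auto. now apply EU.
  + intros c Hc. rewrite <- EM. auto.
Qed.

(** By [ground_rule_instance], closedness makes the filtered instances exactly the ground rules with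
    a head atom in [U], so the finite test is exact. *)
Lemma stableb_spec P n U M :
  closedb (instances P (S n)) U = true -> incl U (base_level P n) -> incl M U ->
  stableb (filter (fun g => meets U g) (instances P (S n))) M = true <->
  stable_on P (fun a => In a U) (fun a => In a M).
Proof.
intros HU HUn HM. set (R := filter _ _).
assert (HR : forall g, In g R <-> ground_rule P g /\ exists a, In a (head g) /\ In a U).
{ intros g. unfold R. rewrite filter_In, meets_spec. split; intros [H1 H2]; split; auto.
  - eapply instances_ground; eauto.
  - eapply ground_rule_instance; eauto. }
assert (Hsat : forall N, forallb (fun g => satb M N g) R = true <->
  forall g, ground_rule P g /\ (exists a, In a (head g) /\ In a U) ->
    sat (fun a => In a M) (fun a => In a N) g).
{ intros N. rewrite forallb_forall. split; intros HN g Hg; apply satb_spec, HN, HR, Hg. }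
unfold stableb. rewrite andb_true_iff, Hsat, forallb_forall. split.
- intros [H1 H2]. split; [exact HM|split; [exact H1|]]. intros N HN HS a Ha.
  (* The competitor is contained in [M], hence has the same members as an enumerated sublist. *)
  destruct (sublists_select N M) as (N' & HN' & E).
  specialize (H2 N' HN'). rewrite implb_spec, Hsat, forallb_mem in H2.
  apply (E a), H2; auto. intros g Hg Hneg Hpos.
  destruct (HS g Hg Hneg) as (b & Hb & Hb').
  + intros b Hb. apply (E b), Hpos, Hb.
  + exists b. split; auto. apply E. auto.
- intros (_ & H1 & H2). split; auto. intros N HN.
  rewrite implb_spec, Hsat, forallb_mem. intros HS.
  exact (H2 (fun a => In a N) (sublists_incl M N HN) HS).
Qed.

Definition atoms_of_formula (F : formula) : list atom :=
  formula_fold (fun a => [a]) (fun l => l) (@app atom) (@app atom) (@app atom) F.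

Lemma coversb_spec U F : coversb U F = true <-> incl (atoms_of_formula F) U.
Proof.
unfold coversb, atoms_of_formula. induction F; simpl; auto;
  try (rewrite andb_true_iff, IHF1, IHF2; split;
       [intros []; now apply incl_app|intros Hi; apply incl_app_inv in Hi; auto]).
rewrite mem_spec. split; [intros Ha b [<-|[]]; auto|]. intros Ha; apply Ha; now left.
Qed.

Lemma holdsb_spec M F : holdsb M F = true <-> holds (fun a => In a M) F.
Proof.
unfold holdsb. induction F; simpl.
- apply mem_spec.
- rewrite <- IHF. destruct (formula_fold _ _ _ _ _ F); simpl; intuition congruence.
- now rewrite andb_true_iff, IHF1, IHF2.
- now rewrite orb_true_iff, IHF1, IHF2.
- now rewrite implb_spec, IHF1, IHF2.
Qed.

Lemma holds_ext (M N : interp) F :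
  (forall a, In a (atoms_of_formula F) -> (M a <-> N a)) -> (holds M F <-> holds N F).
Proof.
unfold atoms_of_formula. induction F; simpl; intros E; auto.
- now rewrite IHF.
- rewrite IHF1, IHF2; [reflexivity| |]; intros b Hb; apply E, in_or_app; auto.
- rewrite IHF1, IHF2; [reflexivity| |]; intros b Hb; apply E, in_or_app; auto.
- rewrite IHF1, IHF2; [reflexivity| |]; intros b Hb; apply E, in_or_app; auto.
Qed.

(** * Splitting and compactness *)


Lemma subst_term_in sig s t :
  (forall n, term_in sig (s n)) -> incl (funs_term t) sig -> term_in sig (subst_term s t).
Proof.
intros Hs. induction t as [n|f ts IH] using term_nested_ind; [intros _; apply Hs|].
intros Hi. simpl subst_term. apply term_in_Fn. rewrite length_map. split.
- apply Hi. now left.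
- apply Forall_map, Forall_forall. intros u Hu. rewrite Forall_forall in IH.
  apply IH; auto. intros x Hx. apply Hi. right. apply in_flat_map. eauto.
Qed.

Lemma ground_rule_herbrand P g b :
  ground_rule P g -> In b (atoms_of_rule g) -> herbrand_atom P b.
Proof.
intros (r & s & Hr & Hs & ->). rewrite atoms_subst_rule. intros Hb.
apply in_map_iff in Hb as ([p ts] & <- & Ha). split.
- apply in_flat_map. exists r. split; auto. apply in_map_iff. exists (At p ts).
  now rewrite length_map.
- apply Forall_map, Forall_forall. intros t Ht. apply subst_term_in; [exact Hs|].
  intros x Hx. assert (Hp : In x (funs_prog P)).
  { apply in_flat_map. exists r. split; auto. apply in_flat_map. exists (At p ts).
    split; auto. apply in_flat_map. eauto. }
  unfold herbrand_funs. destruct (existsb _ _); [auto|now right].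
Qed.

Lemma in_head_atoms a g : In a (head g) -> In a (atoms_of_rule g).
Proof. intros Ha. apply in_or_app. now left. Qed.

Lemma in_body_atoms l g : In l (body g) -> In (atom_of_lit l) (atoms_of_rule g).
Proof. intros Hl. apply in_or_app. right. now apply in_map. Qed.

Lemma in_pos_body a g : In a (pos_body g) -> In (Pos a) (body g).
Proof.
unfold pos_body. rewrite in_flat_map. intros ([b|b] & Hb & Ha); [|easy].
destruct Ha as [->|[]]. exact Hb.
Qed.

Lemma pos_body_atoms a g : In a (pos_body g) -> In a (atoms_of_rule g).
Proof. intros Ha. exact (in_body_atoms (Pos a) g (in_pos_body a g Ha)). Qed.

Lemma model_of_reduct_sat P M N :
  model_of_reduct P M N <-> forall g, ground_rule P g -> sat M N g.
Proof.
split.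
- intros HN g Hg Hneg Hpos. apply (HN (head g) (pos_body g)); auto. exists g. auto.
- intros HS h b (g & Hg & Hneg & -> & ->). exact (HS g Hg Hneg).
Qed.

(** Heads are nonempty, so every ground rule has a head atom in the Herbrand base; and whatever lies
    below a Herbrand interpretation is Herbrand. *)
Lemma stable_model_on P M : disjunctive_program P ->
  stable_model P M <-> stable_on P (herbrand_atom P) M.
Proof.
intros HP.
assert (Hmeet : forall g, ground_rule P g -> exists a, In a (head g) /\ herbrand_atom P a).
{ intros g Hg. pose proof Hg as (r & s & Hr & _ & ->). specialize (HP r Hr).
  destruct (head r) as [|a l] eqn:E; [easy|]. exists (subst_atom s a).
  assert (Ha : In (subst_atom s a) (head (subst_rule s r))) by (simpl; rewrite E; now left).
  split; auto. eapply ground_rule_herbrand; eauto using in_head_atoms. }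
unfold stable_model, stable_on, herbrand_interp. rewrite model_of_reduct_sat. split.
- intros (H1 & H2 & H3). split; [exact H1|split].
  + intros g [Hg _]. auto.
  + intros N HN HS. apply H3; auto. apply model_of_reduct_sat. auto.
- intros (H1 & H2 & H3). split; [exact H1|split].
  + intros g Hg. auto.
  + intros N _ HR HN. apply H3; auto. intros g [Hg _].
    exact (proj1 (model_of_reduct_sat P M N) HR g Hg).
Qed.

Definition restrict (M U : interp) : interp := fun a => M a /\ U a.

(** Splitting: a smaller model [N] of the part over [U], enlarged by the atoms of [M] outside [U],
    is a model of the whole reduct below [M]; minimality of [M] then forces [N] to contain all of
    [M] in [U]. *)
Lemma stable_on_restrict P (U V M : interp) :
  closed P U -> (forall a, U a -> V a) -> stable_on P V M -> stable_on P U (restrict M U).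
Proof.
intros HU HUV (H1 & H2 & H3). unfold restrict. split; [intros a []; auto|split].
- intros g (Hg & a & Ha & HaU) Hneg Hpos.
  pose proof (HU g Hg (ex_intro _ a (conj Ha HaU))) as Hat.
  destruct (H2 g) as (b & Hb & HbM).
  + eauto.
  + intros b Hb HbM. apply (Hneg b Hb). split; auto. exact (Hat b (in_body_atoms (Neg b) g Hb)).
  + intros b Hb. now apply Hpos.
  + exists b. auto using in_head_atoms.
- intros N HN HS a [HaM HaU].
  enough (N a \/ M a /\ ~ U a) by tauto. revert a HaM HaU.
  enough (HM : forall a, M a -> N a \/ M a /\ ~ U a) by auto.
  apply H3; [intros a [Ha|[]]; auto; now apply HN|].
  intros g [Hg Hv] Hneg Hpos.
  (* A rule whose head meets [U] lies inside [U] and is satisfied by [N]. Any other rule has all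
     head atoms outside [U], so the head atom given by [M] belongs to the competitor. *)
  destruct (classic (exists a, In a (head g) /\ U a)) as [Hm|Hno].
  + pose proof (HU g Hg Hm) as Hat.
    destruct (HS g (conj Hg Hm)) as (b & Hb & HbN); eauto.
    * intros b Hb [HbM _]. exact (Hneg b Hb HbM).
    * intros b Hb. destruct (Hpos b Hb) as [|[_ []]]; auto using pos_body_atoms.
  + destruct (H2 g (conj Hg Hv) Hneg) as (b & Hb & HbM).
    * intros b Hb. destruct (Hpos b Hb) as [HbN|[]]; auto. now apply HN.
    * exists b. split; auto. right. split; auto. intros HbU. eauto.
Qed.

(** Stability is local: each rule over [V] lies inside some [U n], and a competitor of [M], cut down
    to [U n], competes with the restriction of [M]. *)
Lemma stable_on_union P (U : nat -> interp) (V M : interp) :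
  (forall n, closed P (U n)) -> (forall a, V a <-> exists n, U n a) ->
  (forall a, M a -> V a) -> (forall n, stable_on P (U n) (restrict M (U n))) ->
  stable_on P V M.
Proof.
intros HU HUV HM HS. unfold restrict in HS. split; [exact HM|split].
- intros g (Hg & a & Ha & HaV) Hneg Hpos. destruct (proj1 (HUV a) HaV) as [n Hn].
  pose proof (HU n g Hg (ex_intro _ a (conj Ha Hn))) as Hat.
  destruct (proj1 (proj2 (HS n)) g) as (b & Hb & HbM & _).
  + eauto.
  + intros b Hb [HbM _]. exact (Hneg b Hb HbM).
  + intros b Hb. auto using pos_body_atoms.
  + eauto.
- intros N HN HR a Ha. destruct (proj1 (HUV a) (HM a Ha)) as [n Hn].
  enough (restrict N (U n) a) as [] by auto.
  apply (proj2 (proj2 (HS n))); auto; unfold restrict.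
  + intros b []; auto.
  + intros g [Hg Hm] Hneg Hpos. pose proof (HU n g Hg Hm) as Hat.
    destruct (HR g) as (b & Hb & HbN).
    * split; auto. destruct Hm as (b & Hb & HbU). exists b. split; auto. apply HUV. eauto.
    * intros b Hb HbM. apply (Hneg b Hb). split; auto.
      exact (Hat b (in_body_atoms (Neg b) g Hb)).
    * intros b Hb. now apply Hpos.
    * exists b. auto using in_head_atoms.
Qed.

(* The bits of the limit are chosen one after the other, keeping infinitely many
   members of the sequence in agreement with all the bits chosen so far. *)
Lemma cantor_compact (Q : nat -> nat -> Prop) :
  exists M : nat -> Prop, forall K n, exists j, n <= j /\ forall k, k < K -> (Q j k <-> M k).
Proof.
set (inf := fun (R : nat -> Prop) => forall n, exists j, n <= j /\ R j).
(* Bit [K] is set exactly when infinitely many members that agree with the earlier bits have it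
   set. *)
set (step := fun K (p : nat -> Prop) k =>
  p k \/ k = K /\ inf (fun j => (forall i, i < K -> (Q j i <-> p i)) /\ Q j K)).
set (approx := nat_rect (fun _ => nat -> Prop) (fun _ => False) step).
assert (Hlt : forall K k, approx K k -> k < K).
{ induction K as [|K IH]; simpl; [easy|]. intros k [Hk|[-> _]]; [apply IH in Hk|]; lia. }
assert (Hst : forall K k, k < K -> (approx K k <-> approx (S k) k)).
{ induction K as [|K IH]; intros k Hk; [lia|].
  destruct (Nat.eq_dec k K) as [->|Hne]; [reflexivity|].
  rewrite <- IH by lia. simpl. unfold step. intuition lia. }
assert (Hgood : forall K, inf (fun j => forall k, k < K -> (Q j k <-> approx K k))).
{ induction K as [|K IH]; intros n; [exists n; split; [auto|lia]|].
  destruct (classic (inf (fun j => (forall i, i < K -> (Q j i <-> approx K i)) /\ Q j K)))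
    as [Hi|Hi].
  - destruct (Hi n) as (j & Hj & Ha & Hb). exists j. split; auto. intros k Hk. simpl.
    unfold step. destruct (Nat.eq_dec k K) as [->|Hne]; [tauto|].
    rewrite Ha by lia. intuition lia.
  (* Beyond [m] no agreeing member has bit [K], so an index past both [n] and [m] agrees with the
     chosen value false. *)
  - apply not_all_ex_not in Hi as [m Hm].
    destruct (IH (max n m)) as (j & Hj & Ha). exists j. split; [lia|]. intros k Hk. simpl.
    unfold step. destruct (Nat.eq_dec k K) as [->|Hne].
    + split.
      * intros HQ. destruct Hm. exists j. split; [lia|auto].
      * intros [HK|[_ Hi]]; [apply Hlt in HK; lia|].
        destruct Hm. apply Hi.
    + rewrite Ha by lia. intuition lia. }
exists (fun k => approx (S k) k). intros K n. destruct (Hgood K n) as (j & Hj & Ha).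
exists j. split; auto. intros k Hk. rewrite Ha by auto. now apply Hst.
Qed.

Lemma depends_herbrand P a b : herbrand_atom P a -> depends P a b -> herbrand_atom P b.
Proof.
intros Ha Hab. induction Hab as [a b (g & Hg & _ & Hb)| |]; auto.
eapply ground_rule_herbrand; eauto.
Qed.

Lemma closed_depends P (Q : atom -> Prop) : closed P (fun b => exists a, Q a /\ depends P a b).
Proof.
intros g Hg (h & Hh & a & Ha & Hah) b Hb. exists a. split; auto.
eapply rt_trans; [exact Hah|]. apply rt_step. exists g. auto.
Qed.

Lemma finite_codes (n : nat) : exists l : list atom, forall a, enc a < n -> In a l.
Proof.
induction n as [|n [l Hl]]; [exists []; lia|].
destruct (classic (exists a : atom, enc a = n)) as [[a Ha]|Hno].
- exists (a :: l). intros b Hb. destruct (Nat.eq_dec (enc b) n) as [E|E].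
  + left. apply enc_atom_inj. congruence.
  + right. apply Hl. lia.
- exists l. intros b Hb. apply Hl. enough (enc b <> n) by lia. eauto.
Qed.

(** Here finite recursion enters: each cone of dependencies is finite and consists of Herbrand
    atoms, hence fits into one level. *)
Lemma cone_bound P l : finitely_recursive P -> Forall (herbrand_atom P) l ->
  exists m, forall a b, In a l -> depends P a b -> In b (base_level P m).
Proof.
intros HP Hl.
destruct (Forall_In_bound
  (fun m a => forall b, depends P a b -> In b (base_level P m)) l) as [m Hm].
- intros m n a Hmn H b Hb. exact (base_level_incl P m n Hmn b (H b Hb)).
- eapply Forall_impl; [|exact Hl]. intros a Ha.
  destruct (HP a (herbrand_ground P a Ha)) as [s Hs].
  (* The list [s] may contain atoms outside the cone, even non-Herbrand ones; only the cone is
     kept. *)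
  destruct (sublists_select (depends P a) s) as (s' & _ & Es).
  destruct (Forall_In_bound (fun m b => In b (base_level P m)) s') as [m Hm].
  + intros m n b Hmn. now apply base_level_incl.
  + apply Forall_forall. intros b Hb. apply herbrand_base_level.
    apply Es in Hb as [_ Hb]. now apply (depends_herbrand P a).
  + exists m. intros b Hb. rewrite Forall_forall in Hm. apply Hm, Es. auto.
- exists m. intros a b Ha. rewrite Forall_forall in Hm. exact (Hm a Ha b).
Qed.

Lemma atoms_of_formula_herbrand P F :
  formula_of P F -> Forall (herbrand_atom P) (atoms_of_formula F).
Proof.
unfold atoms_of_formula.
induction F; simpl; intros HF; auto; destruct HF; apply Forall_app; auto.
Qed.

Lemma check_sound P F n : disjunctive_program P ->
  check P F n = true -> skeptical_consequence P F.
Proof.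
intros HP Hc M HM. apply (stable_model_on P M HP) in HM.
unfold check in Hc. apply existsb_exists in Hc as (U & HUn & Hc).
rewrite !andb_true_iff in Hc. destruct Hc as [[HF HU] Hall].
apply sublists_incl in HUn. apply coversb_spec in HF.
(* [M'] lists the atoms of [U] true in [M]; by splitting it is stable over [U], so the test applies
   to it. *)
destruct (sublists_select M U) as (M' & HM' & E).
rewrite forallb_forall in Hall. specialize (Hall M' HM').
rewrite implb_spec, (stableb_spec P n U M' HU HUn), holdsb_spec in Hall
  by now apply sublists_incl.
apply (holds_ext (fun a => In a M')); [|apply Hall].
- intros a Ha. rewrite E. specialize (HF a Ha). tauto.
- apply (stable_on_ext P (fun a => In a U) _ (restrict M (fun a => In a U))).
  + reflexivity.
  + intros a. rewrite E. unfold restrict. tauto.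
  + apply (stable_on_restrict P _ (herbrand_atom P)); auto.
    * now apply (closedb_closed P n).
    * intros a Ha. apply herbrand_base_level. eauto.
Qed.

(** Reduces completeness to finding a closed set inside one level; such a set is then matched by an
    enumerated list. *)
Lemma check_pass P F n (U : interp) :
  closed P U -> (forall a, U a -> In a (base_level P n)) ->
  (forall a, In a (atoms_of_formula F) -> U a) ->
  (forall M, stable_on P U M -> holds M F) -> check P F n = true.
Proof.
intros HU HUn HF Hall. unfold check. apply existsb_exists.
destruct (sublists_select U (base_level P n)) as (l & Hl & E).
assert (El : forall a, In a l <-> U a) by (intros a; rewrite E; specialize (HUn a); tauto).
assert (Hc : closedb (instances P (S n)) l = true).
{ apply closed_closedb. intros g Hg (a & Ha & HaU) b Hb. apply El, (HU g Hg); auto.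
  exists a. split; auto. now apply El. }
exists l. split; auto. rewrite !andb_true_iff. split; [split; auto|].
- apply coversb_spec. intros a Ha. now apply El, HF.
- apply forallb_forall. intros M HM. apply sublists_incl in HM.
  rewrite implb_spec, (stableb_spec P n l M Hc), holdsb_spec; auto using sublists_incl.
  intros HS. apply Hall. apply (stable_on_ext P (fun a => In a l) _ (fun a => In a M)); auto.
  reflexivity.
Qed.

Lemma check_complete P F : disjunctive_program P -> finitely_recursive P -> formula_of P F ->
  skeptical_consequence P F -> exists n, check P F n = true.
Proof.
intros HP HR HF HS. apply NNPP. intros Hno.
(* The cones of these atoms form an increasing chain of closed sets that exhausts the Herbrand base
   and always contains the atoms of [F]. *)
set (start := fun n a => In a (atoms_of_formula F) \/ herbrand_atom P a /\ enc a < n).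
set (U := fun n b => exists a, start n a /\ depends P a b).
pose proof (atoms_of_formula_herbrand P F HF) as HFh.
assert (Hsh : forall n a, start n a -> herbrand_atom P a).
{ intros n a [Ha|[]]; auto. rewrite Forall_forall in HFh. auto. }
assert (HUcl : forall n, closed P (U n)) by (intros; apply closed_depends).
assert (HUm : forall m n a, m <= n -> U m a -> U n a).
{ intros m n b Hmn (a & [Ha|[Ha Hc]] & Hab); exists a; split; auto; [now left|].
  right. split; auto. lia. }
assert (HUF : forall n a, In a (atoms_of_formula F) -> U n a).
{ intros n a Ha. exists a. split; [now left|apply rt_refl]. }
assert (HUV : forall a, herbrand_atom P a <-> exists n, U n a).
{ intros a. split.
  - intros Ha. exists (S (enc a)), a. split; [right; auto|apply rt_refl].
  - intros (n & b & Hb & Hba). eapply depends_herbrand; eauto. }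
assert (HUb : forall n, exists m, forall a, U n a -> In a (base_level P m)).
{ intros n. destruct (finite_codes n) as [l Hl].
  destruct (sublists_select (start n) (atoms_of_formula F ++ l)) as (s & _ & Es).
  destruct (cone_bound P s HR) as [m Hm].
  - apply Forall_forall. intros a Ha. apply Es in Ha as [_ Ha]. eauto.
  - exists m. intros b (a & Ha & Hab). apply (Hm a); auto. apply Es. split; auto.
    apply in_or_app. destruct Ha as [|[_ Ha]]; auto. }
assert (Hex : forall n, exists M, stable_on P (U n) M /\ ~ holds M F).
{ intros n. apply NNPP. intros Hn. destruct (HUb n) as [m Hm]. apply Hno. exists m.
  apply (check_pass P F m (U n)); auto. intros M HM. apply NNPP. eauto. }
pose (Mod := fun n => proj1_sig (constructive_indefinite_description _ (Hex n))).
assert (HMod : forall n, stable_on P (U n) (Mod n) /\ ~ holds (Mod n) F).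
{ intros n. apply (proj2_sig (constructive_indefinite_description _ (Hex n))). }
(* The counter-models become bit sequences indexed by codes of atoms. *)
destruct (cantor_compact (fun n k => exists a, enc a = k /\ Mod n a)) as [L HL].
set (M := restrict (fun a => L (enc a)) (herbrand_atom P)).
assert (Hagree : forall n, exists j, n <= j /\ forall a, U n a -> (Mod j a <-> M a)).
{ intros n. destruct (HUb n) as [m Hm].
  (* The code of a list exceeds the codes of its members, so agreement below it covers all of
     [U n]. *)
  destruct (HL (enc (base_level P m)) n) as (j & Hj & Ha). exists j. split; auto.
  intros a HaU. specialize (Ha (enc a) (enc_In a _ (Hm a HaU))).
  assert (Hh : herbrand_atom P a) by (apply HUV; eauto).
  unfold M, restrict. rewrite <- Ha. split; [eauto|].
  intros [(b & Eb & Hb) _]. apply enc_atom_inj in Eb. now subst. }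
destruct (Hagree 0) as (j & _ & Hj). apply (proj2 (HMod j)).
apply (holds_ext _ M); [auto|]. apply HS, (stable_model_on P M HP).
apply (stable_on_union P U); auto; [now intros a []|].
(* On [U n] the limit coincides with some [Mod i] with [n <= i]; as [U n] is contained in [U i],
   splitting makes this restriction stable over [U n]. *)
intros n. destruct (Hagree n) as (i & Hi & Ha).
apply (stable_on_ext P (U n) _ (restrict (Mod i) (U n))); [reflexivity| |].
- intros a. unfold restrict. specialize (Ha a). tauto.
- apply (stable_on_restrict P (U n) (U i)); auto; [intros a; now apply HUm|apply HMod].
Qed.

Theorem theorem5p3 :
  exists c : PR,
    forall (P : program) (F : formula),
      disjunctive_program P ->
      finitely_recursive P ->
      formula_of P F ->
      (pr_eval c [enc_input P F] 1 <-> skeptical_consequence P F).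
Proof.
destruct comp_check as (g & Hg & Eg).
(* [d] computes 1 minus the test, so a zero means success; its first argument is the certificate,
   since [PMu] puts the searched number in front. *)
destruct (rec2_comp2 _ _ _ rec2_sub
  (rec2_comp1 (fun _ => 1) (fun m _ => m) (rec1_const 1) rec2_l)
  (rec2_comp1 _ _ Hg (rec2_comp2 _ _ _ rec2_cpair rec2_r rec2_l))) as [d Hd].
destruct (rec1_const 1) as [one Hone].
(* Composition with the constant 1 discards the certificate found and turns halting into the answer
   1. *)
exists (PComp one [PMu d]). intros P F HP HR HF.
assert (Hd' : forall n, pr_eval d [n; enc_input P F] (if check P F n then 0 else 1)).
{ intros n. specialize (Hd n (enc_input P F)). cbv beta in Hd.
  assert (E : g (cpair (enc_input P F) n) = enc (check P F n)) by exact (Eg ((P, F), n)).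
  rewrite E in Hd. destruct (check P F n); exact Hd. }
split.
- intros Hev. inversion Hev as [| | |? ? ? ys ? Hs _| | |]; subst.
  inversion Hs as [|? ? ? n ? Hmu _]; subst.
  inversion Hmu as [| | | | | |? ? ? H0 _]; subst.
  apply (check_sound P F n HP).
  pose proof (pr_eval_det _ _ _ _ H0 (Hd' n)) as E. now destruct (check P F n).
- intros HS. destruct (check_complete P F HP HR HF HS) as [n0 Hn0].
  (* [ev_mu] requires the least certificate, with the search defined and nonzero at every smaller
     number. *)
  assert (Hmin : exists n, check P F n = true /\ forall m, m < n -> check P F m = false).
  { induction n0 as [n0 IH] using lt_wf_ind.
    destruct (classic (exists m, m < n0 /\ check P F m = true)) as [(m & Hm & Hc)|Hno].
    - exact (IH m Hm Hc).
    - exists n0. split; auto. intros m Hm. apply not_true_is_false. eauto. }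
  destruct Hmin as (n & Hn & Hlt).
  econstructor; [apply evals_1, ev_mu with (n := n)|apply Hone].
  + specialize (Hd' n). now rewrite Hn in Hd'.
  + intros m Hm. exists 0. specialize (Hd' m). now rewrite (Hlt m Hm) in Hd'.
Qed.
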